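(* Let $\Phi:M_d\to M_n$ be a unital entanglement breaking (UEB) map. The following statements are equivalent. (i) $\Phi$ is a $C^*$-extreme UEB map. (ii) $\Phi$ is a linear extreme UEB map with commutative range. (iii) $\Phi$ is a maximal UEB map. (iv) $\Phi$ has the form $\Phi(X)=\sum_{i=1}^{\ell}\phi_i(X)P_i$, where the $\phi_i$ are distinct linear extremal states on $M_d$ and the $P_i$ are mutually orthogonal projections in $M_n$ satisfying $\sum_{i=1}^{\ell}P_i=I_n$. (v) The Choi-rank of $\Phi$ is $n$. (vi) If $C_\Phi=\sum_{j=1}^m\xi_j\xi_j^*$ with $\xi_j\in\mathbb{C}^d\otimes\mathbb{C}^n$ and $SR(\xi_j)=1$ for each $j\in\{1,\dots,m\}$, then $m\ge n$ and there exist $\gamma_1,\dots,\gamma_n\in\mathbb{C}^d\otimes\mathbb{C}^n$ with $SR(\gamma_j)=1$ such that $C_\Phi=\sum_{j=1}^n\gamma_j\gamma_j^*$. (vii) If $\Phi(X)=\sum_{i=1}^kV_i^*XV_i$ for all $X\in M_d$, where each $V_i$ has rank one for $i\in\{1,\dots,k\}$, then $k\ge n$ and there exist matrices $W_1,\dots,W_n$ of rank one such that $\Phi(X)=\sum_{i=1}^nW_i^*XW_i$ for all $X\in M_d$. (viii) The EB-rank of $\Phi$ is $n$.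
   Context: $M_k$ denotes the complex $k\times k$ matrices, identified with $B(\mathbb{C}^k)$; a superscript $+$ denotes positive (semidefinite) elements. For a separable complex Hilbert space $K$, a linear map $\Phi:M_d\to B(K)$ is unital if $\Phi(I_d)=I_K$, and entanglement breaking (EB) if for every $k\in\mathbb{N}$ and every $X\in (M_k\otimes M_d)^+$, $(\mathrm{id}_{M_k}\otimes\Phi)(X)$ lies in the norm closure in $B(\mathbb{C}^k\otimes K)$ of $M_k^+\otimes B(K)^+ := \{\sum_{m=1}^{\ell}A_m\otimes B_m : \ell\in\mathbb{N},\ A_m\in M_k^+,\ B_m\in B(K)^+\}$ (already closed if $K$ is finite dimensional). UEB means unital and EB; $\mathrm{UEB}(M_d,M_n)$ is the set of all UEB maps $M_d\to M_n$. $\Phi$ has commutative range if $\Phi(X)\Phi(Y)=\Phi(Y)\Phi(X)$ for all $X,Y$. Linear extreme UEB map: whenever $\Phi=\sum_{i=1}^kt_i\Phi_i$ with $\Phi_i\in\mathrm{UEB}(M_d,M_n)$, $t_i\in(0,1)$, $\sum_it_i=1$, then $\Phi_i=\Phi$ for all $i$. A state is a unital positive linear functional; a linear extremal state on $M_d$ is an extreme point of the convex set of states on $M_d$. $C^*$-extreme UEB map: whenever $\Phi(X)=\sum_{i=1}^kT_i^*\Phi_i(X)T_i$ for all $X\in M_d$, with $\Phi_i\in\mathrm{UEB}(M_d,M_n)$ and invertible $T_i\in M_n$ satisfying $\sum_iT_i^*T_i=I_n$, there exist unitaries $U_i\in M_n$ with $\Phi_i(X)=U_i^*\Phi(X)U_i$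 for all $X\in M_d$ and all $i$. Maximal UEB map: for every separable Hilbert space $K$, every UEB map $\Psi:M_d\to B(K)$ and every isometry $V:\mathbb{C}^n\to K$ with $\Phi(X)=V^*\Psi(X)V$ for all $X\in M_d$, one has $\Psi(X)V=V\Phi(X)$ for all $X\in M_d$. The Choi matrix of $\Phi$ is $C_\Phi=\sum_{i,j=1}^de_ie_j^*\otimes\Phi(e_ie_j^* )\in M_d\otimes M_n$, with $\{e_1,\dots,e_d\}$ the standard basis of $\mathbb{C}^d$. The Schmidt rank $SR(\xi)$ of $\xi\in\mathbb{C}^d\otimes\mathbb{C}^n$ is the smallest natural number $k$ such that $\xi=\sum_{i=1}^kx_i\otimes y_i$ with $x_i\in\mathbb{C}^d$, $y_i\in\mathbb{C}^n$ (so $SR(\xi)=1$ means $\xi$ is a nonzero product vector). The Choi-rank of $\Phi$ is the minimum number $\ell$ of linear maps $V_k:\mathbb{C}^n\to\mathbb{C}^d$ needed to write $\Phi(X)=\sum_{k=1}^\ell V_k^*XV_k$; the EB-rank of $\Phi$ is the minimum such number when all $V_k$ are required to have rank one (such decompositions exist for every EB map). *)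

(* Defs.v *)
From HB Require Import structures.
From mathcomp Require Import all_boot all_order all_algebra.
From mathcomp Require Import sesquilinear spectral.
From mathcomp Require Import complex mxtens.
From mathcomp Require Import all_classical all_reals all_analysis.
Import Order.TTheory GRing.Theory Num.Theory.
Import numFieldNormedType.Exports.

Set Implicit Arguments.
Unset Strict Implicit.
Unset Printing Implicit Defensive.

Local Open Scope classical_set_scope.
Local Open Scope ring_scope.
Local Open Scope complex_scope.
Local Open Scope sesquilinear_scope.

(* Throughout, C := R[i] with R : realType.  The order of R[i] is the partial
   one: 0 <= z says that z is real and nonnegative. *)

(* Inner product of C^n, linear in the first argument as in {dot _ for _}. *)
Definition cdot (C : numClosedFieldType) n (u v : 'cV[C]_n) : C :=
  (v ^t* *m u) 0 0.

Section CdotInstances.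
Variables (C : numClosedFieldType) (n : nat).

Let cdot_bilinear :
  bilinear_for (GRing.Scale.Law.clone _ _ *%R _)
    (GRing.Scale.Law.clone _ _ (@Num.conj C \; *%R) _) (@cdot C n).
Proof.
split=> u a x y /=.
  by rewrite /cdot mulmxDr -scalemxAr !mxE.
by rewrite /cdot raddfD /= map_mxD linearZ /= map_mxZ mulmxDl -scalemxAl !mxE.
Qed.

HB.instance Definition _ := bilinear_isBilinear.Build C 'cV[C]_n 'cV[C]_n C
  _ _ (@cdot C n) cdot_bilinear.

Let cdot_hermitian (u v : 'cV[C]_n) :
  cdot u v = (-1) ^+ false * (cdot v u)^*.
Proof.
rewrite expr0 mul1r /cdot !mxE rmorph_sum; apply: eq_bigr => i _.
by rewrite !mxE rmorphM /= conjCK mulrC.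
Qed.

HB.instance Definition _ := isHermitianSesquilinear.Build C 'cV[C]_n false
  (@Num.conj C) (@cdot C n) cdot_hermitian.

Let cdot_gt0 (u : 'cV[C]_n) : u != 0 -> 0 < cdot u u.
Proof.
move=> u0; have [i ui0] : exists i, u i 0 != 0.
  apply/existsP; apply: contraNT u0; rewrite negb_exists => /forallP h.
  by apply/eqP/colP => i; rewrite mxE; apply/eqP/negPn/h.
rewrite /cdot mxE (bigD1 i) //= ltr_wpDr//.
  by apply: sumr_ge0 => j _; rewrite !mxE mulrC mul_conjC_ge0.
by rewrite !mxE mulrC mul_conjC_gt0.
Qed.

HB.instance Definition _ := isDotProduct.Build C 'cV[C]_n (@cdot C n) cdot_gt0.

End CdotInstances.

Record sepHilbert (R : realType) := SepHilbert {
  hspace :> completeNormedModType R[i];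
  hdot : {dot hspace for @Num.conj R[i]};
  hdot_norm : forall x : hspace, `|x| = sqrtC (hdot x x);
  hspace_separable : exists2 D : set hspace, countable D & dense D }.

Section Operators.
Variables (C : numClosedFieldType) (K : lmodType C).
Variable dot : {dot K for @Num.conj C}.

Definition dnorm (x : K) : C := sqrtC (dot x x).

Definition bounded_op (T : K -> K) : Prop :=
  exists M : C, forall x, dnorm (T x) <= M * dnorm x.

Definition positive_op (T : K -> K) : Prop := forall x, 0 <= dot (T x) x.

(* C^k (x) K is K^k, so that M_k (x) B(K) consists of the k x k matrices with
   entries in B(K). *)
Definition tnorm k (v : 'I_k -> K) : C := sqrtC (\sum_i dot (v i) (v i)).

Definition tens_op k (A : 'M[C]_k) (T : K -> K) (v : 'I_k -> K) : 'I_k -> K :=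
  fun i => \sum_j A i j *: T (v j).

End Operators.

Definition psdmx (C : numClosedFieldType) n (A : 'M[C]_n) : Prop :=
  positive_op (@cdot C n) (mulmx A).

Definition tens_block (T : Type) k d (X : 'M[T]_(k * d)) (i j : 'I_k) : 'M[T]_d :=
  \matrix_(p, q) X (mxtens_index (i, p)) (mxtens_index (j, q)).

Section UEB.
Variables (C : numClosedFieldType) (d : nat) (K : lmodType C).
Variable dot : {dot K for @Num.conj C}.
Implicit Type Psi : 'M[C]_d -> {linear K -> K}.

(* Psi is a linear map from M_d to B(K). *)
Definition linear_map_to_ops Psi : Prop :=
  (forall X, bounded_op dot (Psi X)) /\
  (forall a X Y v, Psi (a *: X + Y) v = a *: Psi X v + Psi Y v).

Definition unital_ops Psi : Prop := forall v, Psi 1%:M v = v.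

(* (id (x) Psi)(X) as an operator on K^k *)
Definition ampliation Psi k (X : 'M[C]_(k * d)) (v : 'I_k -> K) : 'I_k -> K :=
  fun i => \sum_j Psi (tens_block X i j) (v j).

Definition entanglement_breaking Psi : Prop :=
  forall k (X : 'M[C]_(k * d)), psdmx X ->
  forall eps : C, 0 < eps ->
  exists l (A : 'I_l -> 'M[C]_k) (B : 'I_l -> {linear K -> K}),
    [/\ forall m, psdmx (A m),
        forall m, bounded_op dot (B m) /\ positive_op dot (B m) &
        (* operator norm of the difference at most eps *)
        forall v : 'I_k -> K,
          tnorm dot (fun i => ampliation Psi X v i
                              - \sum_m tens_op (A m) (B m) v i)
          <= eps * tnorm dot v].

Definition UEB_ops Psi : Prop :=
  [/\ linear_map_to_ops Psi, unital_ops Psi & entanglement_breaking Psi].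

End UEB.

Section MatrixMaps.
Variables (R : realType) (d n : nat).
Local Notation C := R[i].
Implicit Type Phi : {linear 'M[C]_d -> 'M[C]_n}.

(* M_n is B(C^n). *)
Definition UEB Phi : Prop :=
  UEB_ops (@cdot C n) (fun X => mulmx (Phi X)).

Definition commutative_range Phi : Prop :=
  forall X Y, Phi X *m Phi Y = Phi Y *m Phi X.

Definition linear_extreme_UEB Phi : Prop :=
  UEB Phi /\
  forall k (t : 'I_k -> C) (Phis : 'I_k -> {linear 'M[C]_d -> 'M[C]_n}),
    (forall i, UEB (Phis i)) ->
    (forall i, 0 < t i < 1) -> \sum_i t i = 1 ->
    (forall X, Phi X = \sum_i t i *: Phis i X) ->
    forall i, Phis i =1 Phi.

Definition Cstar_extreme_UEB Phi : Prop :=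
  UEB Phi /\
  forall k (T : 'I_k -> 'M[C]_n) (Phis : 'I_k -> {linear 'M[C]_d -> 'M[C]_n}),
    (forall i, UEB (Phis i)) ->
    (forall i, T i \in unitmx) -> \sum_i (T i) ^t* *m T i = 1%:M ->
    (forall X, Phi X = \sum_i (T i) ^t* *m Phis i X *m T i) ->
    exists U : 'I_k -> 'M[C]_n, forall i,
      U i \is unitarymx /\ forall X, Phis i X = (U i) ^t* *m Phi X *m U i.

Definition maximal_UEB Phi : Prop :=
  UEB Phi /\
  forall (K : sepHilbert R) (Psi : 'M[C]_d -> {linear K -> K})
         (V : {linear 'cV[C]_n -> K}) (Vadj : K -> 'cV[C]_n),
    UEB_ops (@hdot R K) Psi ->
    (forall x, `|V x| = dnorm (@cdot C n) x) ->
    (forall x y, @hdot R K (V x) y = cdot x (Vadj y)) ->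
    (forall X x, Phi X *m x = Vadj (Psi X (V x))) ->
    forall X x, Psi X (V x) = V (Phi X *m x).

Definition Choi_matrix Phi : 'M[C]_(d * n) :=
  \sum_i \sum_j delta_mx i j *t Phi (delta_mx i j).

Definition Kraus_decomposition Phi l (V : 'I_l -> 'M[C]_(d, n)) : Prop :=
  forall X, Phi X = \sum_i (V i) ^t* *m X *m V i.

Definition is_least (P : nat -> Prop) (l : nat) : Prop :=
  P l /\ forall m, P m -> (l <= m)%N.

Definition is_Choi_rank Phi : nat -> Prop :=
  is_least (fun l => exists V : 'I_l -> 'M[C]_(d, n), Kraus_decomposition Phi V).

Definition is_EB_rank Phi : nat -> Prop :=
  is_least (fun l => exists V : 'I_l -> 'M[C]_(d, n),
    (forall i, \rank (V i) = 1%N) /\ Kraus_decomposition Phi V).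

Definition is_Schmidt_rank (xi : 'cV[C]_(d * n)) : nat -> Prop :=
  is_least (fun k => exists (x : 'I_k -> 'cV[C]_d) (y : 'I_k -> 'cV[C]_n),
    xi = \sum_i (x i *t y i)).

End MatrixMaps.

Section States.
Variables (R : realType) (d : nat).
Local Notation C := R[i].
Implicit Type phi : {scalar 'M[C]_d}.

Definition is_state phi : Prop :=
  phi 1%:M = 1 /\ forall X, psdmx X -> 0 <= phi X.

Definition extremal_state phi : Prop :=
  is_state phi /\
  forall (phi1 phi2 : {scalar 'M[C]_d}) (t : C),
    is_state phi1 -> is_state phi2 -> 0 < t < 1 ->
    (forall X, phi X = t * phi1 X + (1 - t) * phi2 X) ->
    phi1 =1 phi /\ phi2 =1 phi.

End States.

Definition is_projection (C : numClosedFieldType) n (P : 'M[C]_n) : Prop :=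
  P ^t* = P /\ P *m P = P.

(* Main.v *)
From HB Require Import structures.
Require Import Defs.
From mathcomp Require Import all_boot all_order all_algebra.
From mathcomp Require Import sesquilinear spectral.
From mathcomp Require Import complex mxtens.
From mathcomp Require Import all_classical all_reals all_analysis.
From mathcomp Require Import ring lra.
Import Order.TTheory GRing.Theory Num.Theory.
Import numFieldTopology.Exports numFieldNormedType.Exports.

(** The proof rests on two facts about UEB maps.

    The first one is the Holevo form [UEB_Holevo]: there are unit vectors u_k
    and vectors y_k with sum_k y_k y_k^* = 1 such that
    Phi X = sum_k <X u_k, u_k> y_k y_k^*. The Choi matrix of Phi is a limit of
    separable matrices, and the separable cone is closed ([product_sum_closed])
    because, by Caratheodory's theorem, sums of boundedly many products fill it,
    and their terms can be kept in a compact set.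

    The second one is a rigidity property, [UEB_pure_vector]: if Psi is a UEB map
    into the operators on K and Psi (1 - u u^* ) is zero at v for the form
    <. v, v>, then Psi X v = <X u, u> v for all X. Complete positivity of Psi
    gives Psi (z w^* ) v = 0 for w orthogonal to u; since the composition of Psi
    with transposition is completely positive too, Psi (w z^* ) v = 0 as well.

    All statements are compared with the form of a direct sum of distinct pure
    states. Given a Holevo form, Phi is such a direct sum as soon as y_k and y_l
    are orthogonal whenever u_k and u_l define different states
    ([orthogonal_blocks_direct_sum]), which is the case if all y_k are joint
    eigenvectors of the range of Phi ([eigenvectors_orthogonal_blocks]).

    If Phi is a direct sum of pure states and X |-> sum_j T_j^* Phis_j X T_j is a
    decomposition of Phi into UEB maps, rigidity at T_j x, for x in the range of
    one of the projections, shows that T_j intertwines Phi and Phis_j. With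
    scalar T_j this is linear extremality; with invertible T_j, polar
    decomposition gives C*-extremality; the same argument at V x gives
    maximality. Conversely, if Phi is C*-extreme, splitting off the fraction
    given by the root of (1 + y_k y_k^* ) / 3 and comparing traces shows that
    y_k is an eigenvector ([Cstar_extreme_eigenvectors]); if Phi is maximal,
    this follows from the dilation diag (<X u_k, u_k>) on C^m
    ([maximal_eigenvectors]); if Phi is linear extreme with commutative range,
    it is diagonal in an orthonormal basis, and the diagonal states are extremal
    ([linear_extreme_commutative_Holevo]). In the last case the Holevo form has
    exactly n terms.

    The statements about ranks follow from [Kraus_length], which computes the
    purity of the Choi matrix in two ways: every Kraus decomposition of a UEB
    map has at least n terms, and if one has exactly n terms, then every Holevo
    form has the orthogonality property above. *)

Set Implicit Arguments.
Unset Strict Implicit.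
Unset Printing Implicit Defensive.
Local Open Scope ring_scope.
Local Open Scope complex_scope.
Local Open Scope sesquilinear_scope.

(** * Inner products *)

Section Dot.
Variables (C : numClosedFieldType) (K : lmodType C).
Variable dot : {dot K for @Num.conj C}.
Implicit Types x y z : K.

Lemma dotC x y : dot x y = (dot y x)^*%R.
Proof. by rewrite (hermC dot) expr0 mul1r. Qed.
Lemma dotDl x y z : dot (x + y) z = dot x z + dot y z.
Proof. exact: linearDl. Qed.
Lemma dotBl x y z : dot (x - y) z = dot x z - dot y z.
Proof. exact: linearBl. Qed.
Lemma dotZl a x z : dot (a *: x) z = a * dot x z.
Proof. by rewrite linearZl_LR. Qed.
Lemma dotDr x y z : dot x (y + z) = dot x y + dot x z.
Proof. exact: linearDr. Qed.
Lemma dotZr a x z : dot x (a *: z) = a^*%R * dot x z.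
Proof. by rewrite linearZr_LR. Qed.
Lemma dotBr x y z : dot x (y - z) = dot x y - dot x z.
Proof. exact: linearBr. Qed.
Lemma dot0l z : dot 0 z = 0. Proof. exact: linear0l. Qed.
Lemma dot0r z : dot z 0 = 0. Proof. exact: linear0r. Qed.
Lemma dot_suml I (r : seq I) (P : pred I) (F : I -> K) z :
  dot (\sum_(i <- r | P i) F i) z = \sum_(i <- r | P i) dot (F i) z.
Proof. exact: linear_sumlz. Qed.
Lemma dot_sumr I (r : seq I) (P : pred I) (F : I -> K) z :
  dot z (\sum_(i <- r | P i) F i) = \sum_(i <- r | P i) dot z (F i).
Proof. exact: linear_sumr. Qed.
Lemma dot_ge0 x : 0 <= dot x x. Proof. exact: dnorm_ge0. Qed.
Lemma dot_eq0 x : (dot x x == 0) = (x == 0). Proof. exact: dnorm_eq0. Qed.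

Lemma dot_eqP x y : (forall z, dot x z = dot y z) -> x = y.
Proof.
move=> h; apply/eqP; rewrite -subr_eq0 -dot_eq0 dotBl h -dotBl.
by rewrite subrr dot0l.
Qed.

(** The square norm of <y, y> x - <x, y> y is nonnegative. *)
Lemma Cauchy_Schwarz x y : `|dot x y| <= dnorm dot x * dnorm dot y.
Proof.
have [->|y0] := eqVneq y 0; first by rewrite /dnorm !dot0r sqrtC0 normr0 mulr0.
have yy0 : 0 < dot y y by rewrite lt_def dot_eq0 y0 dot_ge0.
have h : `|dot x y| ^+ 2 <= dot x x * dot y y.
  have := dot_ge0 (dot y y *: x - dot x y *: y).
  rewrite !(dotBl, dotBr, dotZl, dotZr) (dotC y x).
  rewrite (geC0_conj (dot_ge0 y)) normCK.
  move: (dot x y) (dot y y) (dot x x) yy0 => a b c b0.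
  rewrite (_ : _ - _ = b * (c * b - a * a^*%R)); last by ring.
  by rewrite pmulr_rge0 // subr_ge0.
rewrite /dnorm -sqrtCM ?qualifE /= ?dot_ge0 //.
by rewrite -[X in X <= _]sqrCK // ler_sqrtC // ?qualifE /= ?exprn_ge0 ?mulr_ge0 ?dot_ge0.
Qed.
End Dot.

(** * Linear algebra over a numeric closed field *)

Section Adjoint.
Variable C : numClosedFieldType.
Implicit Types m n p : nat.

Lemma adjmxM m n p (A : 'M[C]_(m, n)) (B : 'M[C]_(n, p)) :
  (A *m B) ^t* = B ^t* *m A ^t*.
Proof. by rewrite trmx_mul map_mxM. Qed.
Lemma adjmxD m n (A B : 'M[C]_(m, n)) : (A + B) ^t* = A ^t* + B ^t*.
Proof. by rewrite linearD map_mxD. Qed.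
Lemma adjmxB m n (A B : 'M[C]_(m, n)) : (A - B) ^t* = A ^t* - B ^t*.
Proof. by rewrite linearB map_mxB. Qed.
Lemma adjmxZ m n a (A : 'M[C]_(m, n)) : (a *: A) ^t* = a^*%R *: A ^t*.
Proof. by rewrite linearZ /= map_mxZ. Qed.
Lemma adjmx1 n : (1%:M : 'M[C]_n) ^t* = 1%:M.
Proof. by rewrite trmx1 map_mx1. Qed.
Lemma adjmx0 m n : (0 : 'M[C]_(m, n)) ^t* = 0.
Proof. by rewrite trmx0 map_mx0. Qed.
Lemma adjmx_sum m n I (r : seq I) (P : pred I) (F : I -> 'M[C]_(m, n)) :
  (\sum_(i <- r | P i) F i) ^t* = \sum_(i <- r | P i) (F i) ^t*.
Proof. by rewrite linear_sum /= map_mx_sum. Qed.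
Lemma adjmxE m n (A : 'M[C]_(m, n)) i j : (A ^t*) i j = (A j i)^*%R.
Proof. by rewrite !mxE. Qed.

(** The rules of the previous section for the function [cdot]. Rewriting with
    the generic rules leaves the bundled inner product in the goal, which later
    steps do not recognize as [cdot]. *)
Section Cdot.
Variables (n : nat).
Implicit Types x y z : 'cV[C]_n.
Lemma cdotC x y : cdot x y = (cdot y x)^*%R.
Proof. exact: dotC. Qed.
Lemma cdotDl x y z : cdot (x + y) z = cdot x z + cdot y z.
Proof. exact: dotDl. Qed.
Lemma cdotBl x y z : cdot (x - y) z = cdot x z - cdot y z.
Proof. exact: dotBl. Qed.
Lemma cdotZl a x z : cdot (a *: x) z = a * cdot x z.
Proof. exact: dotZl. Qed.
Lemma cdotDr x y z : cdot x (y + z) = cdot x y + cdot x z.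
Proof. exact: dotDr. Qed.
Lemma cdotZr a x z : cdot x (a *: z) = a^*%R * cdot x z.
Proof. exact: dotZr. Qed.
Lemma cdot0l z : cdot 0 z = 0. Proof. exact: dot0l. Qed.
Lemma cdot0r z : cdot z 0 = 0. Proof. exact: dot0r. Qed.
Lemma cdot_suml I (r : seq I) (P : pred I) (F : I -> 'cV[C]_n) z :
  cdot (\sum_(i <- r | P i) F i) z = \sum_(i <- r | P i) cdot (F i) z.
Proof. exact: dot_suml. Qed.
Lemma cdot_ge0 x : 0 <= cdot x x. Proof. exact: dot_ge0. Qed.
Lemma cdot_eq0 x : (cdot x x == 0) = (x == 0). Proof. exact: dot_eq0. Qed.
Lemma cdot_eqP x y : (forall z, cdot x z = cdot y z) -> x = y.
Proof. exact: dot_eqP. Qed.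
End Cdot.

Lemma cdotE n (u v : 'cV[C]_n) : cdot u v = \sum_i u i 0 * (v i 0)^*%R.
Proof. by rewrite /cdot mxE; apply: eq_bigr => i _; rewrite !mxE mulrC. Qed.

Lemma cdot_adj m n (A : 'M[C]_(m, n)) u v :
  cdot (A *m u) v = cdot u (A ^t* *m v).
Proof. by rewrite /cdot adjmxM trmxCK mulmxA. Qed.

Lemma cdot_adjr m n (A : 'M[C]_(m, n)) u v :
  cdot u (A *m v) = cdot (A ^t* *m u) v.
Proof. by rewrite cdot_adj trmxCK. Qed.

Lemma mulmx_outer m n (x : 'cV[C]_m) (y z : 'cV[C]_n) :
  x *m y ^t* *m z = cdot z y *: x.
Proof.
rewrite -mulmxA [y ^t* *m z]mx11_scalar mul_mx_scalar /cdot.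
by [].
Qed.

Lemma outer_mulmx m n p (x : 'cV[C]_m) (y : 'cV[C]_n) (z : 'cV[C]_n) (w : 'cV[C]_p) :
  x *m y ^t* *m (z *m w ^t*) = cdot z y *: (x *m w ^t*).
Proof. by rewrite mulmxA mulmx_outer -scalemxAl. Qed.

Lemma adjmx_outer m n (x : 'cV[C]_m) (y : 'cV[C]_n) :
  (x *m y ^t*) ^t* = y *m x ^t*.
Proof. by rewrite adjmxM trmxCK. Qed.

Lemma tr_outer n (x y : 'cV[C]_n) : \tr (x *m y ^t*) = cdot x y.
Proof. by rewrite mxtrace_mulC /mxtrace big_ord1. Qed.

Lemma cdot_delta n (x : 'cV[C]_n) i : cdot x (delta_mx i 0) = x i 0.
Proof.
rewrite cdotE (bigD1 i) //= big1 => [|j ji]; rewrite mxE ?eqxx /=.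
  by rewrite addr0 rmorph1 mulr1.
by rewrite (negbTE ji) rmorph0 mulr0.
Qed.

Lemma mulmx_delta m n (A : 'M[C]_(m, n)) j : A *m delta_mx j 0 = col j A.
Proof. by rewrite colE. Qed.

Lemma mxE_cdot m n (A : 'M[C]_(m, n)) i j :
  A i j = cdot (A *m delta_mx j 0) (delta_mx i 0).
Proof. by rewrite cdot_delta mulmx_delta mxE. Qed.

Lemma cV_sum_delta n (v : 'cV[C]_n) : v = \sum_j v j 0 *: delta_mx j 0.
Proof.
apply/colP => i; rewrite summxE (bigD1 i) //= big1 => [|j ji].
  by rewrite !mxE !eqxx mulr1 addr0.
by rewrite !mxE eq_sym (negbTE ji) mulr0.
Qed.

Lemma sum_outer_delta n : \sum_i (delta_mx i 0 : 'cV[C]_n) *m (delta_mx i 0) ^t*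
   = 1%:M.
Proof.
apply/matrixP => i j; rewrite summxE (bigD1 i) //= big1 => [|k ki].
  by rewrite mxE big_ord1 !mxE !eqxx addr0 mul1r rmorph_nat andbT eq_sym.
by rewrite mxE big_ord1 !mxE eq_sym (negbTE ki) mul0r.
Qed.

(** Parseval's identity for a tight frame. *)
Lemma cdot_sum_outer n m (y : 'I_m -> 'cV[C]_n) : \sum_k y k *m (y k) ^t* = 1%:M ->
  forall x z, cdot x z = \sum_k cdot x (y k) * cdot (y k) z.
Proof.
move=> y1 x z; rewrite -[x in LHS]mul1mx -y1 mulmx_suml cdot_suml.
by apply: eq_bigr => k _; rewrite mulmx_outer cdotZl.
Qed.

(** Membership in [psdmx] unfolds to an inequality about the bundled inner
    product; [psdI] and [psdE] restate it for the function [cdot], on which the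
    rewriting rules above apply. *)
Lemma psdI n (A : 'M[C]_n) : (forall x, 0 <= cdot (A *m x) x) -> psdmx A.
Proof. exact. Qed.
Lemma psdE n (A : 'M[C]_n) : psdmx A -> forall x, 0 <= cdot (A *m x) x.
Proof. exact. Qed.

Lemma psd_outer n (x : 'cV[C]_n) : psdmx (x *m x ^t*).
Proof.
by apply: psdI => y; rewrite mulmx_outer cdotZl (cdotC y x) mulrC mul_conjC_ge0.
Qed.

Lemma psd_sum n I (r : seq I) (P : pred I) (F : I -> 'M[C]_n) :
  (forall i, P i -> psdmx (F i)) -> psdmx (\sum_(i <- r | P i) F i).
Proof.
move=> h; apply: psdI => x; rewrite mulmx_suml cdot_suml; apply: sumr_ge0 => i /h; exact.
Qed.

Lemma psdZ n a (A : 'M[C]_n) : 0 <= a -> psdmx A -> psdmx (a *: A).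
Proof. by move=> a0 hA; apply: psdI => x; rewrite -scalemxAl cdotZl mulr_ge0 ?psdE. Qed.

Lemma psd_congr m n (B : 'M[C]_(n, m)) (A : 'M[C]_n) :
  psdmx A -> psdmx (B ^t* *m A *m B).
Proof. by move=> hA; apply: psdI => x; rewrite -!mulmxA cdot_adj trmxCK; apply: psdE. Qed.

Lemma psd_gram m n (B : 'M[C]_(n, m)) : psdmx (B ^t* *m B).
Proof. by apply: psdI => x; rewrite -mulmxA cdot_adj trmxCK cdot_ge0. Qed.

(** Polarization: the form x |-> <A x, x> takes real values, in particular at
    x + y and at x + 'i y. *)
Lemma psd_herm n (A : 'M[C]_n) : psdmx A -> A ^t* = A.
Proof.
move=> hA; apply/matrixP => i j; rewrite adjmxE !mxE_cdot.
move: (delta_mx i 0) (delta_mx j 0) => x y.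
have h (z : 'cV[C]_n) : (cdot (A *m z) z)^*%R = cdot (A *m z) z.
  exact/geC0_conj/psdE.
have e1 : cdot (A *m (x + y)) (x + y) = cdot (A *m x) x + cdot (A *m y) y +
    (cdot (A *m x) y + cdot (A *m y) x).
  by rewrite mulmxDr !(cdotDl, cdotDr); ring.
have e2 : cdot (A *m (x + 'i *: y)) (x + 'i *: y) =
    cdot (A *m x) x + cdot (A *m y) y +
    'i * (cdot (A *m y) x - cdot (A *m x) y).
  rewrite mulmxDr -scalemxAr !(cdotDl, cdotDr, cdotZl, cdotZr) conjCi.
  by rewrite (mulrA (- 'i)) (_ : - 'i * 'i = 1) ?mulNr -?expr2 ?sqrCi ?opprK //; ring.
have := h (x + y); rewrite e1 rmorphD rmorphD /= !h => /addrI h1.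
have := h (x + 'i *: y); rewrite e2 rmorphD rmorphD /= !h => /addrI.
rewrite rmorphM /= conjCi mulNr -mulrN => /(mulfI (neq0Ci C)).
move: h1; rewrite rmorphD rmorphB /=.
set p := cdot (A *m x) y; set q := cdot (A *m y) x => h1 h2.
have : 2 * p^*%R = 2 * q.
  rewrite -[RHS](_ : (p + q) + (q - p) = _) ?[RHS](_ : (p + q) + (q - p) = _); last by ring.
  by rewrite -h1 -h2; ring.
by move/(mulfI _); apply; rewrite pnatr_eq0.
Qed.

Lemma herm_normal n (A : 'M[C]_n) : A ^t* = A -> A \is normalmx.
Proof. by move=> hA; apply/normalmxP; rewrite hA. Qed.

Lemma unitary_adjM n (P : 'M[C]_n) : P \is unitarymx -> P ^t* *m P = 1%:M.
Proof. by move=> hP; rewrite -invmx_unitary // mulVmx ?unitarymx_unit. Qed.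

(** The root is a function of the spectral decomposition, hence commutes with
    whatever commutes with the matrix. *)
Lemma psd_sqrt n (A : 'M[C]_n) : psdmx A ->
  exists S : 'M[C]_n, [/\ S ^t* = S, S *m S = A &
    forall B, B *m A = A *m B -> B *m S = S *m B].
Proof.
move=> hA; have := orthomx_spectralP (herm_normal (psd_herm hA)).
set P := spectralmx A; set e := spectral_diag A => eA.
have Pu : P \is unitarymx by exact: spectral_unitarymx.
rewrite (invmx_unitary Pu) in eA.
have PP : P *m P ^t* = 1%:M by exact/unitarymxP.
have e0 i : 0 <= e 0 i.
  have := psdE hA (P ^t* *m delta_mx i 0).
  rewrite cdot_adjr trmxCK {1}eA !mulmxA PP mul1mx -(mulmxA _ P) PP mulmx1.
  by rewrite cdot_delta mulmx_delta !mxE eqxx mulr1n.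
pose D := diag_mx (map_mx sqrtC e).
have DD : D *m D = diag_mx e.
  rewrite /D mulmx_diag; congr diag_mx; apply/rowP => i.
  by rewrite !mxE -expr2 sqrtCK.
have Da : D ^t* = D.
  apply/matrixP => i j; rewrite !mxE rmorphMn /=.
  have [->|] := eqVneq j i; last by rewrite eq_sym !mulr0n.
  by rewrite !mulr1n geC0_conj // sqrtC_ge0.
exists (P ^t* *m D *m P); split.
- by rewrite !adjmxM Da trmxCK mulmxA.
- rewrite eA -DD !mulmxA; congr (_ *m _).
  by rewrite -(mulmxA _ P) PP mulmx1.
move=> B; have [B' BE] : exists B', B = P ^t* *m B' *m P.
  exists (P *m B *m P ^t*); rewrite !mulmxA unitary_adjM // mul1mx -mulmxA.
  by rewrite unitary_adjM // mulmx1.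
have mulE X Y : P ^t* *m X *m P *m (P ^t* *m Y *m P) = P ^t* *m (X *m Y) *m P.
  by rewrite !mulmxA -(mulmxA _ P) PP mulmx1.
rewrite {}BE eA !mulE => BD; congr (_ *m _ *m _); apply/matrixP => i j.
have {BD} : B' *m diag_mx e = diag_mx e *m B'.
  move/(congr1 (fun Z => P *m Z *m P ^t*)): BD.
  by rewrite !mulmxA PP !mul1mx -!(mulmxA _ P (P ^t*)) PP !mulmx1.
move/matrixP => /(_ i j).
have mulD (M : 'M[C]_n) (v : 'rV[C]_n) : (M *m diag_mx v) i j = M i j * v 0 j.
  by rewrite mul_mx_diag mxE.
have Dmul (M : 'M[C]_n) (v : 'rV[C]_n) : (diag_mx v *m M) i j = v 0 i * M i j.
  by rewrite mul_diag_mx mxE.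
rewrite mulD Dmul => BD.
rewrite mulD Dmul !(mxE _ _ 0 _).
have [->|ne] := eqVneq (B' i j) 0; first by rewrite mulr0 mul0r.
by move: BD; rewrite mulrC => /(mulIf ne) ->; rewrite mulrC.
Qed.

(** The vectors are the columns of the square root. *)
Lemma psd_decomp n (A : 'M[C]_n) : psdmx A ->
  exists a : 'I_n -> 'cV[C]_n, A = \sum_r a r *m (a r) ^t*.
Proof.
move=> /psd_sqrt[S [Sa SS _]]; exists (fun r => col r S).
rewrite -{1}SS -{2}Sa -[S in S *m _]mulmx1 -sum_outer_delta mulmx_sumr mulmx_suml.
by apply: eq_bigr => r _; rewrite colE adjmxM !mulmxA.
Qed.

(** A commuting family is triangularized by one unitary, and a triangular
    Hermitian matrix is diagonal. *)
Lemma simultaneous_diag n (I : finType) (f : I -> 'M[C]_n) :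
  (forall i, (f i) ^t* = f i) -> (forall i j, f i *m f j = f j *m f i) ->
  exists (w : 'I_n -> 'cV[C]_n) (a : I -> 'I_n -> C),
  [/\ \sum_j w j *m (w j) ^t* = 1%:M,
      forall j k, cdot (w j) (w k) = (j == k)%:R &
      forall i j, f i *m w j = a i j *: w j].
Proof.
move=> fa fc.
have [P Pu Pt] : cotrigonalizable_in (@unitarymx C n n) [seq f i | i <- enum I].
  by apply: cotrigonalization => _ _ /mapP[i _ ->] /mapP[j _ ->]; exact: fc.
have PP : P *m P ^t* = 1%:M by exact/unitarymxP.
have ft i : is_trig_mx (P *m f i *m P ^t*).
  have /= : similar_trig P (f i) by apply: (allP Pt); rewrite map_f ?mem_enum.
  by rewrite /similar_to conjymx.
exists (fun j => P ^t* *m delta_mx j 0), (fun i j => (P *m f i *m P ^t*) j j).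
split.
- transitivity (P ^t* *m (1%:M *m P)); last by rewrite mul1mx unitary_adjM.
  rewrite -sum_outer_delta mulmx_suml mulmx_sumr.
  by apply: eq_bigr => j _; rewrite adjmxM trmxCK !mulmxA.
- move=> j k; rewrite cdot_adj trmxCK mulmxA PP mul1mx cdot_delta !mxE andbT eq_sym.
  by [].
- move=> i j; set T := P *m f i *m P ^t*.
  have Ta : T ^t* = T by rewrite /T !adjmxM trmxCK fa mulmxA.
  have fE : f i = P ^t* *m T *m P.
    by rewrite /T !mulmxA unitary_adjM // mul1mx -mulmxA unitary_adjM ?mulmx1.
  have /is_trig_mxP Tt : is_trig_mx T by exact: ft.
  clearbody T.
  rewrite fE -(mulmxA _ P) (mulmxA P) PP mul1mx -mulmxA scalemxAr; congr (_ *m _).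
  apply/colP => k; rewrite mulmx_delta !mxE andbT.
  have [->|kj] := eqVneq k j; first by rewrite mulr1.
  rewrite mulr0.
  case: (ltngtP k j) => [||/val_inj] h; last by rewrite h eqxx in kj.
    exact: Tt.
  by rewrite -Ta adjmxE Tt // rmorph0.
Qed.
End Adjoint.

(** * Entanglement breaking maps into the operators of a Hilbert space *)

Section ScalarLimits.
Variable C : numClosedFieldType.

(** The distance between q and |q| is at most twice the distance from q to a
    nonnegative number. *)
Lemma ge0_approx (q : C) :
  (forall eps : C, 0 < eps -> exists2 r : C, 0 <= r & `|q - r| <= eps) -> 0 <= q.
Proof.
move=> h; suff -> : q = `|q| by rewrite normr_ge0.
apply/eqP; rewrite -subr_eq0 -normr_eq0; apply/negPn/negP => n0.
have [e eE] : exists e : C, e = `|q - `|q| | by eexists.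
rewrite -eE in n0; have e0 : 0 < e by rewrite lt_def n0 eE normr_ge0.
have [r r0 hr] := h (e / 4) (divr_gt0 e0 (ltr0Sn _ _)).
have : e <= e / 4 + e / 4.
  rewrite {1}eE (_ : q - `|q| = (q - r) + (`|r| - `|q|)); last by rewrite (ger0_norm r0); ring.
  apply: le_trans (ler_normD _ _) _; apply: lerD => //.
  by apply: le_trans (ler_dist_dist _ _) _; rewrite distrC.
rewrite (_ : e / 4 + e / 4 = e - e / 2); last by field.
by rewrite lerBrDl gerDr => /(lt_le_trans (divr_gt0 e0 (ltr0Sn _ 1))); rewrite ltxx.
Qed.

(** The real-linear part must vanish, since it is unbounded below otherwise;
    evaluating it at 1 and at 'i gives two equations in b and c. *)
Lemma ge0_affine_eq0 (b c e : C) :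
  (forall l : C, 0 <= l^*%R * b + l * c + e) -> c = 0.
Proof.
move=> h; have e0 : 0 <= e by have := h 0; rewrite rmorph0 !mul0r !add0r.
have h0 (l : C) : l^*%R * b + l * c = 0.
  apply/eqP/negPn/negP; set s := _ + _ => s0.
  have sr : s \is Num.real.
    by rewrite -[s](addrK e) rpredB ?ger0_real // h.
  have := h (- (e + 1) / s * l); rewrite rmorphM /=.
  rewrite (_ : (- (e + 1) / s)^*%R = - (e + 1) / s); last first.
    by rewrite conj_Creal // rpred_div // rpredN ger0_real // addr_ge0.
  rewrite -!mulrA -!mulrDr -/s mulVf // mulr1 opprD addrAC addNr add0r.
  by rewrite oppr_ge0 ler10.
have h1 := h0 1; have h2 := h0 'i%R.
rewrite rmorph1 !mul1r in h1.
rewrite conjCi mulNr addrC -mulrBr in h2.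
move/eqP: h2; rewrite mulf_eq0 (negbTE (neq0Ci C)) subr_eq0 /= => /eqP h2.
move: h1; rewrite -h2 -mulr2n => /eqP; rewrite mulrn_eq0 /= => /eqP.
by [].
Qed.
End ScalarLimits.

Section EntanglementBreaking.
Variables (C : numClosedFieldType) (K : lmodType C).
Variable dot : {dot K for @Num.conj C}.

Lemma dnormx_ge0 (x : K) : 0 <= dnorm dot x.
Proof. by rewrite /dnorm sqrtC_ge0 dot_ge0. Qed.

Lemma dnormx0 : dnorm dot (0 : K) = 0.
Proof. by rewrite /dnorm dot0l sqrtC0. Qed.

Lemma dnormxZ a (x : K) : dnorm dot (a *: x) = `|a| * dnorm dot x.
Proof.
rewrite /dnorm dotZl dotZr mulrA -normCK sqrtCM ?qualifE /= ?exprn_ge0 ?dot_ge0 //.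
by rewrite sqrCK.
Qed.

Lemma dnormx_triangle (x y : K) : dnorm dot (x + y) <= dnorm dot x + dnorm dot y.
Proof.
rewrite -(@ler_pXn2r _ 2) ?qualifE /= ?addr_ge0 ?dnormx_ge0 //.
rewrite {1}/dnorm sqrtCK dotDl !dotDr sqrrD /dnorm !sqrtCK.
rewrite (dotC _ y x).
have h := Cauchy_Schwarz dot x y.
rewrite -[leLHS](_ : dot x x + (dot x y + (dot x y)^*%R) + dot y y = _); last by ring.
rewrite lerD2r lerD2l mulr2n; apply: (@le_trans _ _ `|dot x y + (dot x y)^*%R|).
  by apply: real_ler_norm; apply/CrealP; rewrite rmorphD /= conjCK addrC.
by apply: le_trans (ler_normD _ _) _; rewrite norm_conjC lerD.
Qed.

Lemma dnormx_sum I (r : seq I) (P : pred I) (F : I -> K) :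
  dnorm dot (\sum_(i <- r | P i) F i) <= \sum_(i <- r | P i) dnorm dot (F i).
Proof.
apply: (big_ind2 (fun a b => dnorm dot a <= b)) => //; first by rewrite dnormx0.
move=> x1 x2 y1 y2 h1 h2; apply: le_trans (dnormx_triangle _ _) _; exact: lerD.
Qed.

Lemma tnorm_ge0 k (v : 'I_k -> K) : 0 <= tnorm dot v.
Proof.
have h (j : 'I_k) : true -> 0 <= dot (v j) (v j) by rewrite dot_ge0.
by rewrite /tnorm sqrtC_ge0 sumr_ge0.
Qed.

Lemma dot_le_tnorm k (v : 'I_k -> K) i : dnorm dot (v i) <= tnorm dot v.
Proof.
have h (j : 'I_k) : true -> 0 <= dot (v j) (v j) by rewrite dot_ge0.
rewrite /dnorm /tnorm ler_sqrtC ?qualifE /= ?h ?sumr_ge0 //.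
by rewrite (bigD1 i) //= lerDl sumr_ge0 // => j _; rewrite h.
Qed.

Variable d : nat.
Variable Psi : 'M[C]_d -> {linear K -> K}.
Hypothesis EB : entanglement_breaking dot Psi.

(** The approximation by separable operators read entry by entry: the norm
    estimate is tested on vectors with a single nonzero component. *)
Lemma EB_approx k (X : 'M[C]_(k * d)) (eps : C) : psdmx X -> 0 < eps ->
  exists l (A : 'I_l -> 'M[C]_k) (B : 'I_l -> {linear K -> K}),
    [/\ forall m, psdmx (A m), forall m, positive_op dot (B m) &
     forall i j s t,
      `|dot (Psi (tens_block X i j) s - \sum_m A m i j *: B m s) t|
         <= eps * (dnorm dot s * dnorm dot t)].
Proof.
move=> hX e0; have [l [A [B [hA hB hE]]]] := EB hX e0.
exists l, A, B; split => // [m|i j s t]; first by case: (hB m).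
pose v j' : K := if j' == j then s else 0.
have tv : tnorm dot v = dnorm dot s.
  rewrite /tnorm /dnorm (bigD1 j) //= big1 => [|j' jj]; rewrite /v.
    by rewrite eqxx addr0.
  by rewrite (negbTE jj) dot0l.
have -> : Psi (tens_block X i j) s - \sum_m A m i j *: B m s
   = ampliation Psi X v i - \sum_m tens_op (A m) (B m) v i.
  congr (_ - _).
    rewrite /ampliation (bigD1 j) //= big1 => [|j' jj]; rewrite /v.
      by rewrite eqxx addr0.
    by rewrite (negbTE jj) linear0.
  apply: eq_bigr => m _; rewrite /tens_op (bigD1 j) //= big1 => [|j' jj]; rewrite /v.
    by rewrite eqxx addr0.
  by rewrite (negbTE jj) linear0 scaler0.
apply: le_trans (Cauchy_Schwarz _ _ _) _; rewrite mulrA ler_wpM2r ?dnormx_ge0 //.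
rewrite -tv; apply: le_trans (hE v).
exact: (dot_le_tnorm (fun i => _ : K) i).
Qed.

(** The double sum is <B w, w> for w = sum_j a_j^* v_j. *)
Lemma sep_form_ge0 k (a : 'I_k -> C) (B : {linear K -> K}) (v : 'I_k -> K) :
  positive_op dot B ->
  0 <= \sum_i \sum_j dot ((a i * (a j)^*%R) *: B (v j)) (v i).
Proof.
move=> hB; rewrite (_ : \sum_i _ = dot (B (\sum_j (a j)^*%R *: v j))
   (\sum_i (a i)^*%R *: v i)) ?hB //.
rewrite dot_sumr; apply: eq_bigr => i _.
rewrite dotZr conjCK linear_sum dot_suml mulr_sumr; apply: eq_bigr => j _.
by rewrite linearZ !dotZl mulrA.
Qed.

Definition swapif T (b : bool) (i j : T) := if b then j else i.

(** The transposed blocks are positive as well, and this is what separates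
    entanglement breaking from complete positivity: in an approximating sum of
    tensors A_m, B_m the transpose of A_m is positive together with A_m. *)
Lemma EB_block_ge0 (b : bool) k (X : 'M[C]_(k * d)) (v : 'I_k -> K) : psdmx X ->
  0 <= \sum_i \sum_j
     dot (Psi (tens_block X (swapif b i j) (swapif b j i)) (v j)) (v i).
Proof.
move=> hX; apply: ge0_approx => eps e0.
pose M := \sum_i \sum_j dnorm dot (v j) * dnorm dot (v i).
have M0 : 0 <= M.
  by apply: sumr_ge0 => i _; apply: sumr_ge0 => j _; rewrite mulr_ge0 ?dnormx_ge0.
(* M may be 0, hence the division by M + 1. *)
have M1 : 0 < M + 1 by rewrite ltr_wpDl.
have [l [A [B [hA hB hE]]]] := EB_approx hX (divr_gt0 e0 M1).
exists (\sum_i \sum_j dot (\sum_m A m (swapif b i j) (swapif b j i) *: B m (v j)) (v i)).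
  rewrite (_ : \sum_i _ = \sum_m \sum_i \sum_j
     dot (A m (swapif b i j) (swapif b j i) *: B m (v j)) (v i)); last first.
    rewrite [RHS]exchange_big /=; apply: eq_bigr => i _.
    rewrite [RHS]exchange_big /=; apply: eq_bigr => j _.
    by rewrite dot_suml.
  apply: sumr_ge0 => m _; have [a ->] := psd_decomp (hA m).
  pose a' r i := if b then (a r i 0)^*%R else a r i 0.
  rewrite (_ : \sum_i _ = \sum_r \sum_i \sum_j
     dot ((a' r i * (a' r j)^*%R) *: B m (v j)) (v i)); last first.
    rewrite [RHS]exchange_big /=; apply: eq_bigr => i _.
    rewrite [RHS]exchange_big /=; apply: eq_bigr => j _.
    rewrite summxE scaler_suml dot_suml; apply: eq_bigr => r _.
    rewrite mxE big_ord1 !mxE /a' /swapif; case: (b) => //.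
    by rewrite conjCK mulrC.
  by apply: sumr_ge0 => r _; exact: sep_form_ge0.
rewrite -sumrB; apply: le_trans (ler_norm_sum _ _ _) _.
have -> : eps = eps / (M + 1) * (M + 1) by rewrite divfK ?gt_eqF.
apply: (@le_trans _ _ (eps / (M + 1) * M)); last first.
  by rewrite ler_wpM2l ?lerDl // divr_ge0 ?ltW.
rewrite mulr_sumr; apply: ler_sum => i _.
rewrite -sumrB; apply: le_trans (ler_norm_sum _ _ _) _.
rewrite mulr_sumr; apply: ler_sum => j _.
by rewrite -dotBl.
Qed.

Hypothesis Psi_lin : linear_map_to_ops dot Psi.

Lemma opsP a X Y v : Psi (a *: X + Y) v = a *: Psi X v + Psi Y v.
Proof. by case: Psi_lin => _ ->. Qed.
Lemma opsD X Y v : Psi (X + Y) v = Psi X v + Psi Y v.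
Proof. by rewrite -[X]scale1r opsP !scale1r. Qed.
Lemma ops0 v : Psi 0 v = 0.
Proof. by apply: (addrI (Psi 0 v)); rewrite -opsD !addr0. Qed.
Lemma opsZ a X v : Psi (a *: X) v = a *: Psi X v.
Proof. by rewrite -[_ *: X]addr0 opsP ops0 addr0. Qed.
Lemma opsZr X a v : Psi X (a *: v) = a *: Psi X v.
Proof. exact: linearZ. Qed.
Lemma ops_sum I (r : seq I) (P : pred I) (F : I -> 'M[C]_d) v :
  Psi (\sum_(i <- r | P i) F i) v = \sum_(i <- r | P i) Psi (F i) v.
Proof. by apply: (big_morph (Psi^~ v)) => [X Y|]; rewrite ?opsD ?ops0. Qed.

Lemma EB_pair_ge0 (b : bool) (w z : 'cV[C]_d) (s t : K) :
  0 <= dot (Psi (w *m w ^t*) s) s + dot (Psi (swapif b w z *m (swapif b z w) ^t*) t) s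
     + (dot (Psi (swapif b z w *m (swapif b w z) ^t*) s) t + dot (Psi (z *m z ^t*) t) t).
Proof.
pose xi (i : 'I_2) := if i == 0 then w else z.
pose X := \col_r (xi (mxtens_unindex r).1 (mxtens_unindex r).2 0).
have XE i j : tens_block (X *m X ^t*) i j = xi i *m (xi j) ^t*.
  apply/matrixP => p q; rewrite /tens_block mxE !mxE !big_ord1 !mxE.
  by rewrite !mxtens_indexK.
have := EB_block_ge0 b (fun i : 'I_2 => if i == 0 then s else t) (psd_outer X).
rewrite !big_ord_recl !big_ord0 !addr0 /=.
by rewrite !XE /xi; case: b.
Qed.

(** A positive two by two form whose diagonal term at v vanishes has vanishing
    off-diagonal terms at v. The first equation comes from the blocks
    themselves, the second one from the transposed blocks. *)
Lemma EB_annihil (w z : 'cV[C]_d) v : dot (Psi (w *m w ^t*) v) v = 0 ->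
  Psi (z *m w ^t*) v = 0 /\ Psi (w *m z ^t*) v = 0.
Proof.
move=> h; split; apply: (@dot_eqP _ _ dot) => t; rewrite dot0l.
- apply: (@ge0_affine_eq0 _ (dot (Psi (w *m z ^t*) t) v) _ (dot (Psi (z *m z ^t*) t) t)).
  move=> l; have := EB_pair_ge0 false w z (l *: v) t.
  by rewrite !opsZr !dotZr !dotZl h !mulr0 add0r addrA.
- apply: (@ge0_affine_eq0 _ (dot (Psi (z *m w ^t*) t) v) _ (dot (Psi (z *m z ^t*) t) t)).
  move=> l; have := EB_pair_ge0 true w z (l *: v) t.
  by rewrite !opsZr !dotZr !dotZl h !mulr0 add0r addrA.
Qed.

Lemma EB_outer_ge0 (w : 'cV[C]_d) v : 0 <= dot (Psi (w *m w ^t*) v) v.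
Proof.
by have := EB_pair_ge0 false w 0 v 0; rewrite !(linear0 (Psi _)) !dot0r dot0l !addr0.
Qed.

Lemma EB_positive X v : psdmx X -> 0 <= dot (Psi X v) v.
Proof.
move=> /psd_decomp[a ->]; rewrite ops_sum dot_suml; apply: sumr_ge0 => r _.
exact: EB_outer_ge0.
Qed.

(** Rigidity at a pure state. The projection Q = 1 - u u^* is a sum of w w^*
    with <Psi (w w^* ) v, v> = 0, so [EB_annihil] kills Psi (Y Q) v and
    Psi (Q Y) v for every Y; modulo matrices of these two kinds X equals
    <X u, u> u u^*, and Psi (u u^* ) v = Psi 1 v = v. *)
Lemma UEB_pure_vector (u : 'cV[C]_d) (v : K) : unital_ops Psi ->
  cdot u u = 1 -> dot (Psi (1%:M - u *m u ^t*) v) v = 0 ->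
  forall X, Psi X v = cdot (X *m u) u *: v.
Proof.
move=> Psi1 u1 hv X; set Q : 'M[C]_d := 1%:M - u *m u ^t* in hv.
have Qa : Q ^t* = Q by rewrite /Q adjmxB adjmx1 adjmx_outer.
have QQ : Q *m Q = Q.
  rewrite /Q mulmxBr mulmx1 mulmxBl mul1mx outer_mulmx u1 scale1r subrr subr0.
  by [].
pose w a := Q *m (delta_mx a 0 : 'cV[C]_d).
have QE : Q = \sum_a w a *m (w a) ^t*.
  rewrite -{1}QQ -{1}[Q]mulmx1 -sum_outer_delta mulmx_sumr mulmx_suml.
  by apply: eq_bigr => a _; rewrite /w adjmxM Qa !mulmxA.
have w0 a : dot (Psi (w a *m (w a) ^t*) v) v = 0.
  move: hv; rewrite QE ops_sum dot_suml => /eqP.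
  rewrite psumr_eq0 => [/allP /(_ a)|i _]; last exact: EB_outer_ge0.
  by rewrite mem_index_enum => /(_ isT) /eqP.
have PQ Y : Psi (Y *m Q) v = 0.
  rewrite QE mulmx_sumr ops_sum big1 // => a _; rewrite mulmxA.
  by case: (EB_annihil (Y *m w a) (w0 a)).
have QP Y : Psi (Q *m Y) v = 0.
  rewrite QE mulmx_suml ops_sum big1 // => a _.
  rewrite -[Y]trmxCK -mulmxA -adjmxM.
  by case: (EB_annihil (Y ^t* *m w a) (w0 a)).
have uE : u *m u ^t* = 1%:M - Q by rewrite /Q subKr.
have XE : X = Q *m X + (u *m u ^t* *m X *m Q + cdot (X *m u) u *: (u *m u ^t*)).
  have -> : cdot (X *m u) u *: (u *m u ^t*) = u *m u ^t* *m X *m (u *m u ^t*).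
    by rewrite -(mulmxA _ X) (mulmxA X) outer_mulmx.
  have key : Q + u *m u ^t* = 1%:M by rewrite uE addrC subrK.
  rewrite -mulmxDr key mulmx1.
  rewrite -mulmxDl.
  by rewrite key mul1mx.
rewrite {1}XE !opsD QP PQ !add0r opsZ uE -[1%:M - Q]addrC opsD Psi1.
by rewrite -scaleN1r opsZ -[Q]mulmx1 QP scaler0 add0r.
Qed.
End EntanglementBreaking.

Section VectorState.
Variables (C : numClosedFieldType) (d : nat).

(** The vector functional of u; at unit vectors these are the pure states. *)
Definition vstate (u : 'cV[C]_d) (X : 'M[C]_d) : C := cdot (X *m u) u.

Lemma vstate_is_scalar u : scalar (vstate u).
Proof. by move=> a X Y; rewrite /vstate mulmxDl cdotDl -scalemxAl cdotZl. Qed.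
HB.instance Definition _ u :=
  GRing.isLinear.Build C 'M[C]_d C *%R (vstate u) (vstate_is_scalar u).

Lemma vstate_adj u X : vstate u (X ^t*) = (vstate u X)^*%R.
Proof. by rewrite /vstate cdot_adj trmxCK cdotC. Qed.
End VectorState.

Section StateMaps.
Variable R : realType.
Local Notation C := R[i].

Lemma vstate_is_state d (u : 'cV[C]_d) : cdot u u = 1 ->
  is_state (vstate u : {scalar 'M[C]_d}).
Proof.
move=> u1; split; first by rewrite /= /vstate mul1mx.
by move=> X hX /=; exact: psdE.
Qed.

Lemma sum_mxtens (V : nmodType) k l (F : 'I_(k * l) -> V) :
  \sum_r F r = \sum_a \sum_b F (mxtens_index (a, b)).
Proof.
rewrite (reindex (@mxtens_index k l)) /=; last first.
  by exists (@mxtens_unindex k l) => ? _; rewrite (mxtens_indexK, mxtens_unindexK).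
by rewrite pair_bigA; apply: eq_bigr => -[a b] _.
Qed.

(** The square of the maximally entangled vector sum_a e_a (x) e_a. The
    ampliation of a map at this matrix is the Choi matrix of the map. *)
Lemma psd_delta_blocks (F : numClosedFieldType) d :
  exists2 W : 'M[F]_(d * d), psdmx W & forall a b, tens_block W a b = delta_mx a b.
Proof.
pose xi : 'cV[F]_(d * d) := \col_r ((mxtens_unindex r).1 == (mxtens_unindex r).2)%:R.
exists (xi *m xi ^t*); first exact: psd_outer.
move=> a b; apply/matrixP => i j; rewrite !mxE big_ord1 !mxE !mxtens_indexK /=.
by rewrite rmorph_nat -natrM mulnb eq_sym (eq_sym b).
Qed.

(** Complete positivity of a state: the form of the block matrix at x is the
    value of the state at a compression of X. *)
Lemma psd_state_blocks d k (phi : {scalar 'M[C]_d}) (X : 'M[C]_(k * d)) :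
  is_state phi -> psdmx X -> psdmx (\matrix_(a, b) phi (tens_block X a b)).
Proof.
move=> [_ hphi] hX; apply: psdI => x.
pose Y := \sum_a \sum_b (x b 0 * (x a 0)^*%R) *: tens_block X a b.
rewrite (_ : cdot _ _ = phi Y); last first.
  rewrite cdotE /Y linear_sum; apply: eq_bigr => a _.
  rewrite linear_sum mxE mulr_suml; apply: eq_bigr => b _.
  by rewrite linearZ /= !mxE -mulrA mulrC.
apply: hphi; apply: psdI => y.
pose xy : 'cV[C]_(k * d) := \col_r (x (mxtens_unindex r).1 0 * y (mxtens_unindex r).2 0).
rewrite (_ : cdot _ _ = cdot (X *m xy) xy); first exact: psdE.
rewrite /Y mulmx_suml cdot_suml [RHS]cdotE.
rewrite sum_mxtens.
apply: eq_bigr => a _; rewrite mulmx_suml cdot_suml.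
rewrite (eq_bigr (fun b => \sum_p x b 0 * (tens_block X a b *m y) p 0 *
    ((x a 0)^*%R * (y p 0)^*%R))); last first.
  move=> b _; rewrite -scalemxAl cdotZl cdotE mulr_sumr; apply: eq_bigr => p _.
  by ring.
rewrite exchange_big; apply: eq_bigr => p _ /=.
rewrite [in RHS]mxE [xy _ _]mxE mxtens_indexK rmorphM /= -mulr_suml; congr (_ * _).
rewrite sum_mxtens.
apply: eq_bigr => b _; rewrite mxE mulr_sumr; apply: eq_bigr => q _.
by rewrite !mxE mxtens_indexK /= mulrCA.
Qed.

(** The ampliation at X is the sum of the tensors (phi_j (X_ab))_ab, B_j,
    hence is itself separable. *)
Lemma states_UEB d (K : lmodType C) (dot : {dot K for @Num.conj C}) m
    (phi : 'I_m -> {scalar 'M[C]_d}) (B : 'I_m -> {linear K -> K})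
    (Psi : 'M[C]_d -> {linear K -> K}) :
  (forall j, is_state (phi j)) ->
  (forall j, bounded_op dot (B j)) -> (forall j, positive_op dot (B j)) ->
  (forall v, \sum_j B j v = v) ->
  (forall X v, Psi X v = \sum_j phi j X *: B j v) -> UEB_ops dot Psi.
Proof.
move=> hphi hb hp B1 PsiE; split.
- split=> [X|a X Y v]; last first.
    rewrite !PsiE scaler_sumr -big_split; apply: eq_bigr => j _ /=.
    by rewrite linearP /= scalerDl scalerA.
  have hb' j : exists M, forall v, dnorm dot (phi j X *: B j v) <= M * dnorm dot v.
    have [M hM] := hb j; exists (`|phi j X| * M) => v.
    by rewrite dnormxZ -mulrA ler_wpM2l.
  have [M hM] := choice hb'; exists (\sum_j M j) => v; rewrite PsiE.
  apply: le_trans (dnormx_sum _ _ _ _) _; rewrite mulr_suml.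
  by apply: ler_sum => j _.
- move=> v; rewrite PsiE -[RHS]B1; apply: eq_bigr => j _.
  by case: (hphi j) => -> _; rewrite scale1r.
- move=> k X hX eps e0.
  exists m, (fun j => \matrix_(a, b) phi j (tens_block X a b)), B; split.
  + by move=> j; exact: psd_state_blocks.
  + by move=> j; split.
  + move=> v; rewrite (_ : tnorm dot _ = 0).
      by rewrite mulr_ge0 ?tnorm_ge0 ?ltW.
    rewrite /tnorm big1 ?sqrtC0 // => i _.
    rewrite (_ : _ - _ = 0) ?dot0l //; apply/eqP; rewrite subr_eq0; apply/eqP.
    rewrite /ampliation /tens_op exchange_big; apply: eq_bigr => b _ /=.
    by rewrite PsiE; apply: eq_bigr => j _; rewrite mxE.
Qed.

Lemma mulmx_bounded n (A : 'M[C]_n) : bounded_op (@cdot C n) (mulmx A).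
Proof.
exists (\sum_i dnorm (@cdot C n) (col i A)) => v.
rewrite (_ : A *m v = \sum_i v i 0 *: col i A); last first.
  apply/colP => k; rewrite summxE mxE; apply: eq_bigr => i _.
  by rewrite !mxE mulrC.
apply: le_trans (dnormx_sum _ _ _ _) _; rewrite mulr_suml.
apply: ler_sum => i _; rewrite dnormxZ mulrC ler_wpM2l ?dnormx_ge0 //.
rewrite -[`|_|]sqrCK // ler_sqrtC ?qualifE /= ?exprn_ge0 ?cdot_ge0 //.
rewrite -[leRHS]/(cdot v v) cdotE (bigD1 i) //= normCK lerDl sumr_ge0 // => j _.
exact: mul_conjC_ge0.
Qed.

Lemma states_matrix_UEB d n m (phi : 'I_m -> {scalar 'M[C]_d})
    (A : 'I_m -> 'M[C]_n) (Phi : {linear 'M[C]_d -> 'M[C]_n}) :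
  (forall j, is_state (phi j)) -> (forall j, psdmx (A j)) ->
  \sum_j A j = 1%:M -> (forall X, Phi X = \sum_j phi j X *: A j) -> UEB Phi.
Proof.
move=> hphi hA A1 PhiE.
apply: (states_UEB (phi := phi) (B := fun j => mulmx (A j))) => //.
- by move=> j; exact: mulmx_bounded.
- by move=> v; rewrite -mulmx_suml A1 mul1mx.
- move=> X v; rewrite /= PhiE mulmx_suml; apply: eq_bigr => j _.
  by rewrite -scalemxAl.
Qed.
End StateMaps.

(** * The separable cone and the Holevo form *)

Section Caratheodory.
Variables (R : realFieldType) (N : nat) (T : Type) (F : T -> 'rV[R]_N).
Variable scl : R -> T -> T.
Hypothesis F_scl : forall c t, 0 <= c -> F (scl c t) = c *: F t.

(** Among more than N vectors of R^N there is a linear dependence; subtracting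
    the largest multiple of it that keeps all coefficients nonnegative makes
    one of them zero. The coefficients are absorbed by [scl], which keeps the
    statement about plain sums. *)
Lemma Caratheodory_step (s : seq T) : (N < size s)%N ->
  exists2 s', size s = (size s').+1 & \sum_(t <- s') F t = \sum_(t <- s) F t.
Proof.
move=> Ns.
pose M := \matrix_i F (tnth (in_tuple s) i).
have [lam lam0 lamM] : exists2 lam : 'rV[R]_(size s), lam != 0 & lam *m M = 0.
  have : kermx M != 0.
    rewrite kermx_eq0; apply/negP => /eqP rM.
    by have := rank_leq_col M; rewrite rM leqNgt Ns.
  by move=> /rowV0Pn[lam /sub_kermxP lamM lam0]; exists lam.
(* The dependence or its opposite has a positive entry. *)
have [mu [i1 mu1] muM] : exists2 mu : 'rV[R]_(size s), (exists i, 0 < mu 0 i) & mu *m M = 0.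
  have [i li] : exists i, lam 0 i != 0.
    apply/existsP; apply: contraNT lam0; rewrite negb_exists => /forallP h.
    by apply/eqP/rowP => i; rewrite mxE; apply/eqP/negPn/h.
  case: (ltrgt0P (lam 0 i)) li => // li _; first by exists lam => //; exists i.
  exists (- lam); last by rewrite mulNmx lamM oppr0.
  by exists i; rewrite mxE oppr_gt0.
have [i0 _ i0max] := @arg_maxP _ _ _ i1 xpredT (fun i => mu 0 i) isT.
have mu0 : 0 < mu 0 i0 by apply: lt_le_trans mu1 (i0max _ _).
(* The choice of i0 makes these coefficients nonnegative, with a zero at i0. *)
pose c i := 1 - mu 0 i / mu 0 i0.
have c0 i : 0 <= c i by rewrite subr_ge0 ler_pdivrMr // mul1r; exact: i0max.
have ci0 : c i0 = 0 by rewrite /c divff ?subrr // gt_eqF.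
exists [seq scl (c i) (tnth (in_tuple s) i) | i <- enum (predC1 i0)].
  rewrite size_map -cardE cardC1 card_ord prednK //.
  by apply: leq_ltn_trans Ns.
rewrite big_map big_enum /=.
transitivity (\sum_i c i *: F (tnth (in_tuple s) i)).
  rewrite [RHS](bigD1 i0) //= ci0 scale0r add0r.
  by apply: eq_bigr => i _; rewrite F_scl.
rewrite [RHS]big_tnth.
have : \sum_i mu 0 i *: F (tnth (in_tuple s) i) = 0.
  transitivity (mu *m M); last exact: muM.
  by rewrite mulmx_sum_row; apply: eq_bigr => i _; rewrite rowK.
move=> h; under eq_bigr do rewrite scalerBl scale1r.
rewrite sumrB [X in _ - X](_ : _ = 0) ?subr0 //.
transitivity ((mu 0 i0)^-1 *: \sum_i mu 0 i *: F (tnth (in_tuple s) i)); last first.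
  by rewrite h scaler0.
rewrite scaler_sumr.
by apply: eq_bigr => i _; rewrite scalerA mulrC.
Qed.

Lemma Caratheodory (s : seq T) :
  exists2 s', (size s' <= N)%N & \sum_(t <- s') F t = \sum_(t <- s) F t.
Proof.
have [k] := ubnP (size s); elim: k s => // k IH s /ltnSE sk.
have [|Ns] := leqP (size s) N; first by exists s.
have [s1 s1s E] := Caratheodory_step Ns.
have [|s' s'N E'] := IH s1; first by rewrite -s1s.
by exists s' => //; rewrite E' E.
Qed.
End Caratheodory.

Section ComplexContinuity.
Variables (R : realType) (T : topologicalType).
Local Notation C := R[i].
Implicit Types f g : T -> C.

(** Continuity of the real and imaginary parts, which is the form in which the
    extreme value theorem on a compact subset of R^N can be applied. *)
Definition ccontinuous f :=
  continuous (fun t => complex.Re (f t)) /\ continuous (fun t => complex.Im (f t)).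

Lemma ccontinuousD f g : ccontinuous f -> ccontinuous g ->
  ccontinuous (fun t => f t + g t).
Proof.
move=> [f1 f2] [g1 g2]; split => t.
  rewrite (_ : (fun _ => _) = (fun t => complex.Re (f t)) \+ (fun t => complex.Re (g t))).
    exact: continuousD (f1 t) (g1 t).
  by apply/funext => u /=; case: (f u) (g u) => [? ?] [? ?].
rewrite (_ : (fun _ => _) = (fun t => complex.Im (f t)) \+ (fun t => complex.Im (g t))).
  exact: continuousD (f2 t) (g2 t).
by apply/funext => u /=; case: (f u) (g u) => [? ?] [? ?].
Qed.

Lemma ccontinuousM f g : ccontinuous f -> ccontinuous g ->
  ccontinuous (fun t => f t * g t).
Proof.
move=> [f1 f2] [g1 g2]; split => t.
  rewrite (_ : (fun _ => _) =
    ((fun t => complex.Re (f t)) \* (fun t => complex.Re (g t))) \-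
    ((fun t => complex.Im (f t)) \* (fun t => complex.Im (g t)))).
    by apply: (@continuousB _ R^o);
      [exact: continuousM (f1 t) (g1 t)|exact: continuousM (f2 t) (g2 t)].
  by apply/funext => u /=; case: (f u) (g u) => [? ?] [? ?].
rewrite (_ : (fun _ => _) =
    ((fun t => complex.Re (f t)) \* (fun t => complex.Im (g t))) \+
    ((fun t => complex.Im (f t)) \* (fun t => complex.Re (g t)))).
  by apply: (@continuousD _ R^o);
    [exact: continuousM (f1 t) (g2 t)|exact: continuousM (f2 t) (g1 t)].
by apply/funext => u /=; case: (f u) (g u) => [? ?] [? ?].
Qed.

Lemma ccontinuous_conj f : ccontinuous f -> ccontinuous (fun t => (f t)^*%R).
Proof.
move=> [f1 f2]; split => t.
  rewrite (_ : (fun _ => _) = (fun t => complex.Re (f t))); first exact: f1.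
  by apply/funext => u /=; case: (f u).
rewrite (_ : (fun _ => _) = (fun t => - complex.Im (f t))).
  by apply: (@continuousN _ R^o); exact: f2.
by apply/funext => u /=; case: (f u).
Qed.

Lemma ccontinuous_sum I (r : seq I) (f : I -> T -> C) :
  (forall i, ccontinuous (f i)) -> ccontinuous (fun t => \sum_(i <- r) f i t).
Proof.
move=> h; elim: r => [|i r IH].
  rewrite (_ : (fun t => _) = fun=> 0); first by split => t; exact: cst_continuous.
  by apply/funext => t; rewrite big_nil.
rewrite (_ : (fun t => _) = fun t => f i t + \sum_(i <- r) f i t).
  exact: ccontinuousD.
by apply/funext => t; rewrite big_cons.
Qed.
End ComplexContinuity.

Section SeparableCone.
Variables (R : realType) (d n : nat).
Local Notation C := R[i].
Local Notation T := ('cV[C]_d * 'cV[C]_n)%type.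
Local Notation E := ('I_d * 'I_d * 'I_n * 'I_n * bool)%type.

(** Entry ((a, p), (b, q)) of x x^* tensored with y y^*, for t = (x, y). *)
Definition product_entry (t : T) a b p q : C :=
  t.1 a 0 * (t.1 b 0)^*%R * (t.2 p 0 * (t.2 q 0)^*%R).

Definition re_im (h : bool) (c : C) : R := if h then complex.Re c else complex.Im c.

Lemma re_imD h c c' : re_im h (c + c') = re_im h c + re_im h c'.
Proof. by case: h c c' => -[? ?] [? ?]. Qed.
Lemma re_im0 h : re_im h 0 = 0. Proof. by case: h. Qed.
Lemma re_im_sum I (r : seq I) (f : I -> C) h :
  re_im h (\sum_(i <- r) f i) = \sum_(i <- r) re_im h (f i).
Proof. by apply: (big_morph (re_im h)) => [c c'|]; rewrite ?re_imD ?re_im0. Qed.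
Lemma re_imZ h (r : R) c : re_im h (r%:C * c) = r * re_im h c.
Proof. by case: h c => -[a b] /=; rewrite ?mul0r ?subr0 ?addr0. Qed.
Lemma re_im_inj c c' : (forall h, re_im h c = re_im h c') -> c = c'.
Proof.
move=> e; apply/eqP; rewrite eq_complex.
by have := e true; have := e false => /= -> ->; rewrite !eqxx.
Qed.
Lemma re_im_le h c : `|re_im h c|%:C <= `|c|.
Proof.
case: h; first exact: normc_ge_Re.
rewrite /= normc_def lecR -[leLHS]sqrtr_sqr ler_sqrt ?addr_ge0 ?sqr_ge0 //.
by rewrite lerDr sqr_ge0.
Qed.

Let F (t : T) : 'rV[R]_#|{: E}| := \row_e
  let: (a, b, p, q, h) := enum_val e in re_im h (product_entry t a b p q).

Let scl (c : R) (t : T) : T := ((Num.sqrt c)%:C *: t.1, t.2).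

Let F_scl c t : 0 <= c -> F (scl c t) = c *: F t.
Proof.
move=> c0; apply/rowP => e; rewrite !mxE; case: (enum_val e) => -[[[a b] p] q] h.
rewrite -re_imZ; congr re_im; rewrite /product_entry /scl /= !mxE rmorphM /=.
rewrite (_ : ((Num.sqrt c)%:C)^*%R = (Num.sqrt c)%:C); last exact: conjc_real.
rewrite -{3}(sqr_sqrtr c0) rmorphXn /=; ring.
Qed.

(** Caratheodory's theorem in the real coordinates of the matrix entries; the
    index type E counts these coordinates. *)
Lemma short_product_sum (s : seq T) : exists t : 'I_#|{: E}| -> T,
  forall a b p q, \sum_j product_entry (t j) a b p q
                = \sum_(t <- s) product_entry t a b p q.
Proof.
have [s' s'N E'] := Caratheodory F_scl s.
exists (fun j => nth (0, 0) s' j) => a b p q.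
have z : product_entry (0, 0) a b p q = 0 by rewrite /product_entry /= !mxE !mul0r.
rewrite -(big_mkord xpredT (fun j => product_entry (nth (0, 0) s' j) a b p q)).
rewrite (big_cat_nat (leq0n _) s'N) /= [X in _ + X]big_nat_cond [X in _ + X]big1 => [|j]; last first.
  by rewrite andbT => /andP[h _]; rewrite nth_default.
rewrite addr0 -(big_nth (0, 0) xpredT (fun t => product_entry t a b p q)).
apply: re_im_inj => h; rewrite !re_im_sum.
move/rowP: E' => /(_ (enum_rank (a, b, p, q, h))).
rewrite !summxE (eq_bigr (fun t => re_im h (product_entry t a b p q))).
  move=> ->; apply: eq_bigr => t _; rewrite mxE enum_rankK; by [].
by move=> t _; rewrite mxE enum_rankK.
Qed.

(** The norm of the first factor is moved to the second one. After this the
    terms of the sums that approximate a given matrix stay in a compact set. *)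
Lemma normalize_product (t : T) : exists2 t' : T,
  (forall a b p q, product_entry t' a b p q = product_entry t a b p q) &
  cdot t'.1 t'.1 = 1 \/ t' = (0, 0).
Proof.
case: t => x y; have [->|x0] := eqVneq x 0.
  exists (0, 0); last by right.
  by move=> a b p q; rewrite /product_entry /= !mxE !mul0r.
have x1 : 0 < cdot x x by rewrite lt_def cdot_eq0 x0 cdot_ge0.
set l := sqrtC (cdot x x); have l0 : 0 < l by rewrite sqrtC_gt0.
have lr : l^*%R = l by rewrite geC0_conj ?ltW.
have lV : (l^-1)^*%R = l^-1 by rewrite geC0_conj // invr_ge0 ltW.
have ln : l != 0 by rewrite gt_eqF.
exists (l^-1 *: x, l *: y).
  move=> a b p q; rewrite /product_entry /= !mxE !rmorphM /= lr lV.
  by field.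
left; rewrite /= cdotZl cdotZr lV mulrA -invfM -expr2 sqrtCK mulVf //.
by rewrite gt_eqF.
Qed.

Variable z : 'I_d -> 'I_d -> 'I_n -> 'I_n -> C.
(** A bound on the entries of all normalized approximants of z: the diagonal
    entries of a sum at distance at most 1 from z are at most |z| + 1. *)
Let B : C := 1 + \sum_a \sum_p (`|z a a p p| + 1).

Let B1 : 1 <= B.
Proof.
rewrite lerDl; apply: sumr_ge0 => a _; apply: sumr_ge0 => p _.
by rewrite addr_ge0.
Qed.

Let sq_le_B (c : C) : `|c| ^+ 2 <= B -> `|c| <= B.
Proof.
move=> cB; have [c1|c1] := real_leP (normr_real c) (@real1 C).
  exact: le_trans c1 B1.
by apply: le_trans cB; rewrite expr2 ler_peMl // ltW.
Qed.

(** The diagonal entries of all terms are nonnegative, so a term is bounded by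
    the sum. *)
Let entries_le_B N (t : 'I_N -> T) :
  (forall j, cdot (t j).1 (t j).1 = 1 \/ t j = (0, 0)) ->
  (forall a p, `|z a a p p - \sum_j product_entry (t j) a a p p| <= 1) ->
  forall j, (forall a, `|(t j).1 a 0| <= B) /\ (forall p, `|(t j).2 p 0| <= B).
Proof.
move=> hn hz j; case: (hn j) => [x1|->]; last first.
  by split=> i /=; rewrite mxE normr0 (le_trans _ B1).
split=> [a|p]; apply: sq_le_B.
  apply: le_trans B1; rewrite -x1 cdotE (bigD1 a) //= normCK lerDl.
  by apply: sumr_ge0 => i _; exact: mul_conjC_ge0.
have pe a p' j' : product_entry (t j') a a p' p' = `|(t j').1 a 0| ^+ 2 * `|(t j').2 p' 0| ^+ 2.
  by rewrite /product_entry !normCK.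
have pe0 a p' j' : 0 <= product_entry (t j') a a p' p'.
  by rewrite pe mulr_ge0 ?exprn_ge0.
rewrite -[leLHS]mul1r -x1 cdotE mulr_suml.
apply: (@le_trans _ _ (\sum_a \sum_p (`|z a a p p| + 1))); last by rewrite lerDr.
apply: ler_sum => a _; rewrite -normCK -pe.
rewrite (bigD1 p) //=; apply: ler_wpDr.
  by apply: sumr_ge0 => p' _; rewrite addr_ge0.
apply: (@le_trans _ _ (\sum_j product_entry (t j) a a p p)).
  by rewrite (bigD1 j) //= lerDl sumr_ge0.
apply: le_trans (real_ler_norm _) _; first by rewrite ger0_real ?sumr_ge0.
rewrite -[X in `|X|](subrK (z a a p p)) addrC.
by apply: le_trans (ler_normD _ _) _; rewrite lerD2l distrC.
Qed.

Let J := ('I_#|{: E}| * ('I_d + 'I_n) * bool)%type.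

(** A family of pairs of vectors is encoded as a point of R^J. *)
Let coord (v : 'rV[R]_#|{: J}|) j (o : 'I_d + 'I_n) : C :=
  Complex (v 0 (enum_rank ((j, o), true))) (v 0 (enum_rank ((j, o), false))).

Let tuple_of (v : 'rV[R]_#|{: J}|) j : T :=
  (\col_a coord v j (inl a), \col_p coord v j (inr p)).

Let vector_of (t : 'I_#|{: E}| -> T) : 'rV[R]_#|{: J}| := \row_e
  let: (j, o, h) := enum_val e in
  re_im h match o with inl a => (t j).1 a 0 | inr p => (t j).2 p 0 end.

Let tuple_ofK t j : tuple_of (vector_of t) j = t j.
Proof.
rewrite /tuple_of [RHS]surjective_pairing; congr pair; apply/colP => i.
  rewrite !mxE /coord !mxE !enum_rankK /=.
  by case: ((t j).1 i 0).
rewrite !mxE /coord !mxE !enum_rankK /=.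
by case: ((t j).2 i 0).
Qed.

Let coord_ccontinuous j o : ccontinuous (fun v => coord v j o).
Proof. by split=> v /=; exact: coord_continuous. Qed.

Local Notation E4 := ('I_d * 'I_d * 'I_n * 'I_n)%type.

(** Subtraction is written with (-1) * to stay within the closure properties of
    [ccontinuous]. *)
Let defect (v : 'rV[R]_#|{: J}|) (e : E4) : C := let: (a, b, p, q) := e in
  z a b p q + (-1) * \sum_j product_entry (tuple_of v j) a b p q.

Let cerr v : C := \sum_e defect v e * (defect v e)^*%R.

Let err v : R := complex.Re (cerr v).

Let cerr_ge0 v : 0 <= cerr v.
Proof. by apply: sumr_ge0 => e _; exact: mul_conjC_ge0. Qed.

Let errE v : (err v)%:C = cerr v.
Proof. by rewrite /err RRe_real // ger0_real. Qed.

Let err_continuous : continuous err.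
Proof.
suff : ccontinuous cerr by case.
have cd e : ccontinuous (fun v => defect v e).
  case: e => -[[a b] p] q; rewrite /defect.
  apply: ccontinuousD; first by split=> ?; exact: cst_continuous.
  apply: ccontinuousM; first by split=> ?; exact: cst_continuous.
  apply: ccontinuous_sum => j; rewrite /product_entry.
  have c1 a' : ccontinuous (fun v => (tuple_of v j).1 a' 0).
    rewrite (_ : (fun _ => _) = fun v => coord v j (inl a')) //.
    by apply/funext => u; rewrite /= mxE.
  have c2 a' : ccontinuous (fun v => (tuple_of v j).2 a' 0).
    rewrite (_ : (fun _ => _) = fun v => coord v j (inr a')) //.
    by apply/funext => u; rewrite /= mxE.
  by apply: ccontinuousM; apply: ccontinuousM => //; apply: ccontinuous_conj.
apply: ccontinuous_sum => e.
by apply: ccontinuousM => //; exact: ccontinuous_conj.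
Qed.

(** The separable cone is closed. The squared distance to z is continuous on a
    compact box of R^J that contains good approximants, so it attains its
    minimum there; as it takes arbitrarily small values, the minimum is 0. *)
Lemma product_sum_closed :
  (forall eps : R, 0 < eps -> exists s : seq T, forall a b p q,
     `|z a b p q - \sum_(t <- s) product_entry t a b p q| <= eps%:C) ->
  exists t : 'I_#|{: E}| -> T,
    forall a b p q, z a b p q = \sum_j product_entry (t j) a b p q.
Proof.
move=> hz; pose Br := complex.Re B.
have BE : B = Br%:C by rewrite RRe_real // ger0_real // (le_trans ler01 B1).
pose A := [set v : 'rV[R]_#|{: J}| | forall i, (`[- Br, Br]%classic : set R) (v ord0 i)]%classic.
have Ac : compact A.
  apply: (@rV_compact R _ (fun=> `[- Br, Br]%classic)) => _; exact: segment_compact.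
have approx (eps : R) : 0 < eps -> eps <= 1 ->
    exists2 v, v \in A & err v <= #|{: E4}|%:R * eps ^+ 2.
  move=> e0 e1; have [s hs] := hz _ e0.
  have [t0 ht0] := short_product_sum s.
  have /choice[t ht] : forall j, exists t' : T,
     (forall a b p q, product_entry t' a b p q = product_entry (t0 j) a b p q) /\
     (cdot t'.1 t'.1 = 1 \/ t' = (0, 0)).
    by move=> j; have [t' h1 h2] := normalize_product (t0 j); exists t'.
  have htz a b p q : `|z a b p q - \sum_j product_entry (t j) a b p q| <= eps%:C.
    rewrite (eq_bigr (fun j => product_entry (t0 j) a b p q)) ?ht0 // => j _.
    by case: (ht j).
  exists (vector_of t).
    rewrite inE => i /=; rewrite mxE in_itv /= -ler_norml -lecR -BE.
    case: (enum_val i) => -[j o] h; apply: le_trans (re_im_le _ _) _.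
    have [] := @entries_le_B _ t (fun j => (ht j).2) _ j.
      move=> a p; apply: le_trans (htz _ _ _ _) _.
      by rewrite -[leRHS]/(1%:C) lecR.
    by move=> h1 h2; case: o.
  rewrite -lecR errE /cerr rmorphM rmorphXn rmorph_nat -sum1_card natr_sum mulr_suml.
  apply: ler_sum => -[[[a b] p] q] _.
  rewrite mul1r -normCK ler_pXn2r ?nnegrE ?normr_ge0 ?ler0c ?(ltW e0) // /defect.
  rewrite mulN1r (eq_bigr (fun j => product_entry (t j) a b p q)) //.
  by move=> j _; rewrite tuple_ofK.
have [v0 v0A _] := approx 1 ltr01 (lexx _).
have [||v vA vmin] := @EVT_min_rV R _ err A _ Ac.
- by exists v0; rewrite inE in v0A.
- by apply: continuous_subspaceT; exact: err_continuous.
exists (tuple_of v).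
have err0 : err v <= 0.
  rewrite leNgt; apply/negP => ev.
  pose M : R := #|{: E4}|%:R + 1.
  have M0 : 0 < M by rewrite ltr_wpDl.
  (* The bound B on approximants holds for eps <= 1. *)
  pose eps := Num.min 1 (err v / (2 * M)).
  have e0 : 0 < eps by rewrite lt_min ltr01 divr_gt0 // mulr_gt0.
  have e1 : eps <= 1 by rewrite ge_min lexx.
  have [w wA wle] := approx _ e0 e1.
  have : err v <= err v / 2.
    apply: le_trans (vmin _ wA) _; apply: le_trans wle _.
    apply: (@le_trans _ _ (M * eps)).
      rewrite ler_pM ?ler0n ?exprn_ge0 ?(ltW e0) //; first by rewrite lerDl.
      by rewrite expr2 ler_piMr // ltW.
    rewrite (_ : err v / 2 = M * (err v / (2 * M))); last by field; rewrite gt_eqF.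
    by rewrite ler_pM2l // ge_min lexx orbT.
  by rewrite ler_pdivlMr // mulr_natr mulr2n gerDl leNgt ev.
move=> a b p q; apply/eqP; rewrite -subr_eq0; apply/eqP.
have : cerr v = 0.
  apply/eqP; rewrite eq_le cerr_ge0 andbT -errE.
  by rewrite -[leRHS]/(0%:C) lecR.
move=> /eqP; rewrite /cerr psumr_eq0 => [/allP /(_ (a, b, p, q))|e _]; last exact: mul_conjC_ge0.
rewrite mem_index_enum => /(_ isT); rewrite /= mul_conjC_eq0 /defect mulN1r.
by move/eqP.
Qed.
End SeparableCone.

Section Holevo.
Variable R : realType.
Local Notation C := R[i].

Lemma linear_cV_matrix n (B : {linear 'cV[C]_n -> 'cV[C]_n}) :
  exists M : 'M[C]_n, forall v, B v = M *m v.
Proof.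
exists (\matrix_(i, j) B (delta_mx j 0) i 0) => v.
rewrite {1}[v]cV_sum_delta linear_sum; apply/colP => i; rewrite summxE mxE.
by apply: eq_bigr => j _; rewrite linearZ !mxE mulrC.
Qed.

Lemma linear_delta_sum d n (Phi : {linear 'M[C]_d -> 'M[C]_n}) X :
  Phi X = \sum_a \sum_b X a b *: Phi (delta_mx a b).
Proof.
rewrite {1}[X]matrix_sum_delta linear_sum; apply: eq_bigr => a _.
by rewrite linear_sum; apply: eq_bigr => b _; rewrite linearZ.
Qed.

Lemma unital_matrix d n (Phi : {linear 'M[C]_d -> 'M[C]_n}) :
  UEB Phi -> Phi 1%:M = 1%:M.
Proof.
move=> [_ hu _]; apply/matrixP => i j;
  have : Phi 1%:M *m delta_mx j 0 = delta_mx j 0 := hu (delta_mx j 0).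
rewrite mulmx_delta => /colP /(_ i); rewrite !mxE => ->.
by rewrite andbT.
Qed.

Lemma UEB_separable_entries d n (Phi : {linear 'M[C]_d -> 'M[C]_n}) : UEB Phi ->
  exists N (t : 'I_N -> 'cV[C]_d * 'cV[C]_n), forall a b p q,
    Phi (delta_mx a b) p q = \sum_j product_entry (t j) a b p q.
Proof.
move=> [_ _ hEB].
have := @product_sum_closed R d n (fun a b p q => Phi (delta_mx a b) p q).
case=> [eps e0|t ht]; last by eexists; exists t.
have [W Wpsd XE] := psd_delta_blocks C d.
have ec0 : 0 < eps%:C by rewrite -[ltLHS]/(0%:C) ltcR.
have [l [A [B [hA hB hE]]]] := EB_approx hEB Wpsd ec0.
have /choice[M hM] : forall m, exists M : 'M[C]_n, forall v, B m v = M *m v.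
  by move=> m; exact: linear_cV_matrix.
have hMp m : psdmx (M m) by apply: psdI => x; rewrite -hM; exact: hB.
have /choice[al hal] := fun m => psd_decomp (hA m).
have /choice[be hbe] := fun m => psd_decomp (hMp m).
exists [seq ((al i.1.1 i.1.2, be i.1.1 i.2) : 'cV[C]_d * 'cV[C]_n)
     | i <- index_enum ('I_l * 'I_d * 'I_n)%type] => a b p q.
have {}hE : `|cdot (Phi (tens_block W a b) *m delta_mx q 0
    - \sum_m A m a b *: B m (delta_mx q 0)) (delta_mx p 0)|
    <= eps%:C * (sqrtC (cdot (delta_mx q 0) (delta_mx q 0)) *
                 sqrtC (cdot (delta_mx p 0) (delta_mx p 0))) := hE a b _ _.
move: hE; rewrite XE mulmx_delta !cdot_delta !mxE !eqxx sqrtC1 !mulr1.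
rewrite summxE big_map.
congr (`|_ - _| <= _).
rewrite -(pair_bigA _ (fun i j => product_entry (al i.1 i.2, be i.1 j) a b p q)) /=.
rewrite -(pair_bigA _ (fun i r => \sum_j product_entry (al i r, be i j) a b p q)) /=.
apply: eq_bigr => m _; rewrite hM mxE mulmx_delta mxE hal hbe !summxE mulr_suml.
apply: eq_bigr => r _; rewrite mulr_sumr; apply: eq_bigr => j _.
by rewrite /product_entry /= !mxE !big_ord1 !mxE.
Qed.

(** The measure-and-prepare form with pure states and rank-one effects. *)
Definition Holevo_form d n (Phi : {linear 'M[C]_d -> 'M[C]_n}) m
    (u : 'I_m -> 'cV[C]_d) (y : 'I_m -> 'cV[C]_n) : Prop :=
  [/\ forall k, cdot (u k) (u k) = 1,
      \sum_k y k *m (y k) ^t* = 1%:M &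
      forall X, Phi X = \sum_k vstate (u k) X *: (y k *m (y k) ^t*)].

(** The Choi matrix is a limit of separable matrices, hence separable; terms
    that vanish are dropped. The vectors u_k are conjugated because the vector
    functional of u maps the matrix unit (a, b) to u_a^* u_b. *)
Lemma UEB_Holevo d n (Phi : {linear 'M[C]_d -> 'M[C]_n}) : UEB Phi ->
  exists m (u : 'I_m -> 'cV[C]_d) (y : 'I_m -> 'cV[C]_n),
  Holevo_form Phi u y /\ forall k, y k != 0.
Proof.
move=> hPhi; have [N [t0 ht0]] := UEB_separable_entries hPhi.
have /choice[t ht] : forall j, exists t' : 'cV[C]_d * 'cV[C]_n,
     (forall a b p q, product_entry t' a b p q = product_entry (t0 j) a b p q) /\
     (cdot t'.1 t'.1 = 1 \/ t' = (0, 0)).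
  by move=> j; have [t' h1 h2] := normalize_product (t0 j); exists t'.
pose P := [pred j | (cdot (t j).1 (t j).1 == 1) && ((t j).2 != 0)].
pose u (k : 'I_#|P|) : 'cV[C]_d := map_mx (@Num.conj C) (t (enum_val k)).1.
pose y (k : 'I_#|P|) := (t (enum_val k)).2.
have u1 k : cdot (u k) (u k) = 1.
  have /andP[/eqP <- _] : P (enum_val k) := enum_valP k.
  rewrite !cdotE; apply: eq_bigr => i _; rewrite !mxE conjCK.
  by rewrite mulrC.
have PhiE X : Phi X = \sum_k vstate (u k) X *: (y k *m (y k) ^t*).
  rewrite linear_delta_sum; apply/matrixP => p q; rewrite !summxE.
  under eq_bigr => a _ do (rewrite summxE; under eq_bigr => b _ do rewrite mxE ht0 mulr_sumr).
  under eq_bigr => a _ do rewrite exchange_big.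
  rewrite exchange_big /= (bigID P) /= [X in _ + X]big1 ?addr0 => [|j Pj]; last first.
    apply: big1 => a _; apply: big1 => b _; case: (ht j) => <- [h|->].
      move: Pj; rewrite /= h eqxx /= negbK => /eqP y0.
      by rewrite /product_entry y0 !mxE !(mul0r, mulr0).
    by rewrite /product_entry /= !mxE !mul0r mulr0.
  rewrite big_enum_val; apply: eq_bigr => k _.
  rewrite !mxE big_ord1 mxE mxE /vstate cdotE mulr_suml; apply: eq_bigr => a _.
  rewrite mxE !mulr_suml; apply: eq_bigr => b _.
  case: (ht (enum_val k)) => <- _; rewrite /product_entry /u /y mxE mxE conjCK.
  ring.
exists #|P|, u, y; split; last first.
  by move=> k; have /andP[] : P (enum_val k) := enum_valP k.
split => //; rewrite -(unital_matrix hPhi) PhiE; apply: eq_bigr => k _.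
by rewrite /vstate mul1mx u1 scale1r.
Qed.
End Holevo.

(** * Finite dimensional Hilbert spaces *)

Section Euclidean.
Variables (R : realType) (m : nat).
Local Notation C := R[i].

Local Open Scope classical_set_scope.
Local Open Scope ring_scope.
(** An alias of the type of columns, which keeps the Euclidean norm apart from
    the maximum norm of matrices. *)
Definition euclid : Type := 'cV[C]_m.
HB.instance Definition _ := GRing.Lmodule.copy euclid 'cV[C]_m.

Definition enorm (v : euclid) : C := dnorm (@cdot C m) v.

Lemma enormD (x y : euclid) : enorm (x + y) <= enorm x + enorm y.
Proof. exact: dnormx_triangle. Qed.
Lemma enormZ (a : C) (x : euclid) : enorm (a *: x) = `|a| * enorm x.
Proof. exact: dnormxZ. Qed.
Lemma enorm0_eq0 (x : euclid) : enorm x = 0 -> x = 0.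
Proof. by move/eqP; rewrite sqrtC_eq0 dot_eq0 => /eqP. Qed.

HB.instance Definition _ :=
  Lmodule_isNormed.Build C euclid enormD enormZ enorm0_eq0.

Let part (o : 'I_m * bool) (v : euclid) : R := re_im o.2 ((v : 'cV[C]_m) o.1 0).

Lemma entry_le_enorm (v : euclid) i : `|(v : 'cV[C]_m) i 0| <= `|v|.
Proof.
rewrite -[leRHS]/(sqrtC (cdot v v)) -[leLHS]sqrCK // ler_sqrtC ?qualifE /= ?exprn_ge0 ?cdot_ge0 //.
rewrite cdotE (bigD1 i) //= normCK lerDl sumr_ge0 // => j _.
exact: mul_conjC_ge0.
Qed.

Let partB o (v w : euclid) : part o (v - w) = part o v - part o w.
Proof.
rewrite /part !mxE; apply: (addIr (re_im o.2 ((w : 'cV[C]_m) o.1 0))).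
by rewrite subrK -re_imD subrK.
Qed.

Let part_le o (v w : euclid) : (`|part o v - part o w|)%:C <= `|v - w|.
Proof.
rewrite -partB; apply: le_trans (entry_le_enorm (v - w) o.1).
exact: re_im_le.
Qed.

Let enorm_le (v : euclid) : `|v| <= (\sum_o `|part o v|)%:C.
Proof.
rewrite -[leLHS]/(dnorm (@cdot C m) v).
rewrite {1}[v](cV_sum_delta (v : 'cV[C]_m)); apply: le_trans (dnormx_sum _ _ _ _) _.
rewrite (_ : \sum_o _ = \sum_i (`|part (i, true) v| + `|part (i, false) v|)); last first.
  rewrite -(pair_bigA _ (fun i h => `|part (i, h) v|)) /=.
  by apply: eq_bigr => i _; rewrite big_bool.
rewrite rmorph_sum; apply: ler_sum => i _ /=.
rewrite dnormxZ (_ : dnorm _ _ = 1) ?mulr1; last first.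
  rewrite -[LHS]/(sqrtC (cdot (delta_mx i 0) (delta_mx i 0))).
  by rewrite cdot_delta !mxE !eqxx sqrtC1.
rewrite /part /=; case: ((v : 'cV[C]_m) i 0) => a b /=.
rewrite lecR -(@ler_pXn2r _ 2) ?nnegrE ?sqrtr_ge0 ?addr_ge0 //.
rewrite sqr_sqrtr ?addr_ge0 ?sqr_ge0 // sqrrD !real_normK ?num_real //.
by rewrite lerD2r lerDl mulrn_wge0 ?mulr_ge0.
Qed.

(** The real and imaginary parts of each entry of a Cauchy filter form a
    Cauchy filter on R. *)
Lemma euclid_complete (F : set_system euclid) : ProperFilter F -> cauchy F -> cvg F.
Proof.
move=> FF /cauchyP Fc.
have lP o : exists l : R, part o @ F --> l.
  suff : cvg (part o @ F) by move=> h; exists (lim (part o @ F)).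
  apply: cauchy_cvg; apply: cauchy_exP => e e0.
  have ec0 : 0 < e%:C by rewrite -[ltLHS]/(0%:C) ltcR.
  have [x Fx] := Fc _ ec0.
  exists (part o x).
  suff : F (part o @^-1` ball (part o x) e) by [].
  apply: filterS Fx => y.
  rewrite -!ball_normE /= -ltcR; apply: le_lt_trans.
  exact: part_le.
have [l hl] := choice lP.
pose L : euclid := (\col_i (Complex (l (i, true)) (l (i, false))) : 'cV[C]_m).
have partL o : part o L = l o by rewrite /part mxE; case: o => i [].
apply: (cvgP L); apply/cvgrPdist_lt => e e0.
have eE : e = (complex.Re e)%:C by rewrite RRe_real // gtr0_real.
pose M : R := #|{: 'I_m * bool}|%:R + 1.
have M0 : 0 < M by rewrite ltr_wpDl.
have e0' : 0 < complex.Re e / M.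
  by rewrite divr_gt0 // -ltcR -eE.
have : \forall v \near F, forall o, `|l o - part o v| < complex.Re e / M.
  apply: filter_forall => o; move: (hl o) => /cvgrPdist_lt /(_ _ e0').
  by [].
apply: filterS => v hv.
apply: le_lt_trans (enorm_le _) _; rewrite eE ltcR.
apply: (@le_lt_trans _ _ (\sum_(o : 'I_m * bool) complex.Re e / M)).
  apply: ler_sum => o _; apply/ltW; apply: le_lt_trans (hv o).
  by rewrite partB partL.
rewrite sumr_const -mulr_natl mulrCA -ltr_pdivlMl; last by rewrite -ltcR -eE.
rewrite mulVf; last by rewrite gt_eqF // -ltcR -eE.
by rewrite ltr_pdivrMr // mul1r ltrDl.
Qed.

HB.instance Definition _ := Uniform_isComplete.Build euclid euclid_complete.

Let rational_vector (q : {ffun 'I_m * bool -> rat}) : euclid :=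
  (\col_i Complex (ratr (q (i, true))) (ratr (q (i, false))) : 'cV[C]_m).

(** Vectors with rational real and imaginary parts are dense. *)
Lemma euclid_separable : exists2 D : set euclid, countable D & dense D.
Proof.
exists (range rational_vector).
  by apply: card_le_trans (card_image_le _ _) _; exact: countableP.
move=> O [x Ox] Oo.
have : nbhs x O by exact: open_nbhs_nbhs.
move=> /nbhs_ballP[e /= e0 eO].
have eE : e = (complex.Re e)%:C by rewrite RRe_real // gtr0_real.
pose M : R := #|{: 'I_m * bool}|%:R + 1.
have M0 : 0 < M by rewrite ltr_wpDl.
have er0 : 0 < complex.Re e by rewrite -ltcR -eE.
have e0' : 0 < complex.Re e / M by rewrite divr_gt0.
have /choice[q hq] : forall o, exists q : rat, `|part o x - ratr q| < complex.Re e / M.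
  move=> o; have /rat_in_itvoo[q] : part o x - complex.Re e / M < part o x + complex.Re e / M.
    by rewrite ltrD2l gtrN.
  rewrite in_itv /= => hq; exists q.
  by rewrite distrC ltr_distl.
exists (rational_vector [ffun o => q o]); split; last by exists [ffun o => q o].
apply: eO; rewrite -ball_normE /=.
apply: le_lt_trans (enorm_le _) _; rewrite eE ltcR.
apply: (@le_lt_trans _ _ (\sum_(o : 'I_m * bool) complex.Re e / M)).
  apply: ler_sum => o _; apply/ltW; apply: le_lt_trans (hq o).
  rewrite partB [part o (rational_vector _)](_ : _ = ratr (q o)) //.
  by rewrite /part mxE !ffunE; case: o => i [].
rewrite sumr_const -mulr_natl mulrCA -ltr_pdivlMl //.
by rewrite mulVf ?gt_eqF // ltr_pdivrMr // mul1r ltrDl.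
Qed.

Definition euclid_dot : {dot euclid for @Num.conj C} := @cdot C m.

Definition euclid_Hilbert : sepHilbert R :=
  @SepHilbert R euclid euclid_dot (fun=> erefl) euclid_separable.
End Euclidean.

(** * Pure states and direct sums of states *)

Section Forms.
Variable R : realType.
Local Notation C := R[i].

Definition scalar_comb d (a b : C) (phi psi : {scalar 'M[C]_d}) (X : 'M[C]_d) : C :=
  a * phi X + b * psi X.
Lemma scalar_comb_is_scalar d a b (phi psi : {scalar 'M[C]_d}) :
  scalar (scalar_comb a b phi psi).
Proof.
move=> c X Y; rewrite /scalar_comb !linearP /=; ring.
Qed.
HB.instance Definition _ d a b (phi psi : {scalar 'M[C]_d}) :=
  GRing.isLinear.Build C 'M[C]_d C *%R (scalar_comb a b phi psi)
    (scalar_comb_is_scalar a b phi psi).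

Lemma vstateZ d a (u : 'cV[C]_d) X : vstate (a *: u) X = `|a| ^+ 2 * vstate u X.
Proof. by rewrite /vstate -scalemxAr cdotZl cdotZr mulrA normCK. Qed.

Lemma vstate1 d (u : 'cV[C]_d) : vstate u 1%:M = cdot u u.
Proof. by rewrite /vstate mul1mx. Qed.

Lemma vstate_coproj d (u v : 'cV[C]_d) :
  vstate v (1%:M - u *m u ^t*) = cdot v v - cdot v u * cdot u v.
Proof. by rewrite /vstate mulmxBl mul1mx mulmx_outer cdotBl cdotZl. Qed.

Lemma vstate_coproj0 d (u : 'cV[C]_d) : cdot u u = 1 ->
  vstate u (1%:M - u *m u ^t*) = 0.
Proof. by move=> u1; rewrite vstate_coproj u1 mulr1 subrr. Qed.

Lemma psd_coproj d (u : 'cV[C]_d) : cdot u u = 1 -> psdmx (1%:M - u *m u ^t*).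
Proof.
move=> u1; have -> : 1%:M - u *m u ^t* = (1%:M - u *m u ^t*) ^t* *m (1%:M - u *m u ^t*).
  rewrite adjmxB adjmx1 adjmx_outer mulmxBr mulmx1 mulmxBl mul1mx outer_mulmx u1.
  by rewrite scale1r subrr subr0.
exact: psd_gram.
Qed.

(** A state is a UEB map into the operators on C^1, where [UEB_pure_vector]
    applies. *)
Lemma state_eq_vstate d (phi : {scalar 'M[C]_d}) u : is_state phi ->
  cdot u u = 1 -> phi (1%:M - u *m u ^t*) = 0 -> phi =1 vstate u.
Proof.
move=> hphi u1 h0 X.
pose Psi (X : 'M[C]_d) : {linear 'cV[C]_1 -> 'cV[C]_1} := mulmx (phi X)%:M.
have [hl hu hE] : UEB_ops (@cdot C 1) Psi.
  apply: (@states_UEB _ _ _ _ 1 (fun=> phi) (fun=> mulmx 1%:M)) => //.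
  - by move=> _; exact: mulmx_bounded.
  - by move=> _; apply: psdI => v; rewrite mul1mx cdot_ge0.
  - by move=> v; rewrite big_ord1 /= mul1mx.
  - by move=> Y v; rewrite big_ord1 /Psi /= !mul_scalar_mx scale1r.
have := UEB_pure_vector hE hl (v := delta_mx 0 0) hu u1 _ X.
rewrite /Psi /= h0 -[LHS]/(cdot _ _) !mul_scalar_mx scale0r cdot0l => /(_ erefl).
by move=> /colP /(_ 0); rewrite !mxE !eqxx !mulr1.
Qed.

(** Both components of a convex decomposition are nonnegative at 1 - u u^*,
    where the vector state of u vanishes. *)
Lemma vstate_extremal d (u : 'cV[C]_d) : cdot u u = 1 ->
  extremal_state (vstate u : {scalar 'M[C]_d}).
Proof.
move=> u1; split; first exact: vstate_is_state.
move=> phi1 phi2 t h1 h2 /andP[t0 t1] e.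
have t1' : 0 < 1 - t by rewrite subr_gt0.
have p1 := h1.2 _ (psd_coproj u1); have p2 := h2.2 _ (psd_coproj u1).
have := e (1%:M - u *m u ^t*); rewrite /= vstate_coproj0 // => /esym /eqP.
rewrite paddr_eq0 ?mulr_ge0 ?(ltW t0) ?(ltW t1') // !mulf_eq0 (gt_eqF t0) (gt_eqF t1') /=.
by move=> /andP[/eqP e1 /eqP e2]; split; exact: state_eq_vstate.
Qed.

(** Decomposition of the density matrix, whose entries are the values of the
    state at the matrix units. *)
Lemma state_sum_vstate d (phi : {scalar 'M[C]_d}) : is_state phi ->
  exists v : 'I_d -> 'cV[C]_d, forall X, phi X = \sum_k vstate (v k) X.
Proof.
move=> hphi; have [W Wpsd WE] := psd_delta_blocks C d.
have [w hw] := psd_decomp (psd_state_blocks hphi Wpsd).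
exists (fun k => map_mx (@Num.conj C) (w k)) => X.
rewrite {1}[X]matrix_sum_delta linear_sum.
under [RHS]eq_bigr => k _ do rewrite /vstate cdotE.
rewrite [RHS]exchange_big; apply: eq_bigr => a _ /=; rewrite linear_sum.
under [RHS]eq_bigr => k _ do rewrite mxE mulr_suml.
rewrite [RHS]exchange_big; apply: eq_bigr => b _ /=; rewrite linearZ /=.
move/matrixP: hw => /(_ a b); rewrite mxE WE summxE => ->; rewrite mulr_sumr.
by apply: eq_bigr => k _; rewrite !mxE big_ord1 !mxE conjCK -!mulrA (mulrC (w k a 0)).
Qed.

(** In a decomposition of phi into vector functionals a nonzero vector v_k
    carries the weight t = <v_k, v_k>. Either t = 1 and the other vectors are
    zero, or extremality applies to t and the normalized v_k. *)
Lemma extremal_is_vstate d (phi : {scalar 'M[C]_d}) : extremal_state phi ->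
  exists2 u : 'cV[C]_d, cdot u u = 1 & phi =1 vstate u.
Proof.
move=> [hphi hext]; have [v hv] := state_sum_vstate hphi.
have v1 : \sum_k cdot (v k) (v k) = 1.
  by rewrite -(hphi.1) hv; apply: eq_bigr => k _; rewrite vstate1.
have [k vk] : exists k, v k != 0.
  apply/existsP; apply: contra_eqT v1; rewrite negb_exists => /forallP h.
  rewrite big1 ?(eq_sym 0) ?oner_neq0 // => k _.
  by move: (h k); rewrite negbK => /eqP ->; rewrite cdot0l.
pose t := cdot (v k) (v k).
have t0 : 0 < t by rewrite lt_def cdot_eq0 vk cdot_ge0.
have st0 : sqrtC t != 0 by rewrite sqrtC_eq0 gt_eqF.
have sr : (sqrtC t)^*%R = sqrtC t by rewrite geC0_conj // sqrtC_ge0 ltW.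
pose u := (sqrtC t)^-1 *: v k.
have nsq : `|(sqrtC t)^-1| ^+ 2 = t^-1.
  by rewrite normfV ger0_norm ?sqrtC_ge0 ?ltW // exprVn sqrtCK.
have uE X : vstate (v k) X = t * vstate u X.
  by rewrite vstateZ nsq mulrA divff ?gt_eqF // mul1r.
have u1 : cdot u u = 1.
  by rewrite -vstate1 vstateZ nsq vstate1 mulVf // gt_eqF.
exists u => //; apply: state_eq_vstate => //.
have rest0 : 0 <= \sum_(j | j != k) cdot (v j) (v j).
  by apply: sumr_ge0 => j _; exact: cdot_ge0.
have restE : \sum_(j | j != k) cdot (v j) (v j) = 1 - t.
  by apply/eqP; rewrite eq_sym subr_eq -v1 (bigD1 k) //= addrC.
rewrite restE in rest0.
have [t1|t1] := eqVneq t 1.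
  rewrite hv (bigD1 k) //= uE vstate_coproj0 // mulr0 add0r big1 // => j jk.
  suff /eqP -> : v j == 0 by rewrite /vstate mulmx0 cdot0l.
  move: restE; rewrite t1 subrr => /eqP; rewrite psumr_eq0; last by move=> *; exact: cdot_ge0.
  by move=> /allP /(_ j); rewrite mem_index_enum jk cdot_eq0 => /(_ isT).
have t1' : 0 < 1 - t by rewrite lt_def rest0 subr_eq0 eq_sym t1.
pose psi : {scalar 'M[C]_d} := scalar_comb (1 - t)^-1 (- (t / (1 - t))) phi (vstate u).
have psiE X : psi X = (1 - t)^-1 * \sum_(j | j != k) vstate (v j) X.
  rewrite /psi /= /scalar_comb hv (bigD1 k) //= uE; field.
  by rewrite gt_eqF.
have hpsi : is_state psi.
  split=> [|X hX]; rewrite psiE.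
    under eq_bigr do rewrite vstate1.
    by rewrite restE mulVf // gt_eqF.
  rewrite mulr_ge0 ?invr_ge0 ?(ltW t1') //; apply: sumr_ge0 => j _.
  exact: psdE.
have [|X|+ _] := hext (vstate u) psi t (vstate_is_state u1) hpsi.
- by rewrite t0 -subr_gt0.
- by rewrite psiE mulrA divff ?gt_eqF // mul1r hv (bigD1 k) //= uE.
- by move=> <-; exact: vstate_coproj0.
Qed.

Definition orthogonal_blocks d n m
    (u : 'I_m -> 'cV[C]_d) (y : 'I_m -> 'cV[C]_n) : Prop :=
  forall k l, vstate (u k) =1 vstate (u l) \/ cdot (y k) (y l) = 0.

Definition direct_sum_of_states d n (Phi : {linear 'M[C]_d -> 'M[C]_n}) : Prop :=
  exists (l : nat) (phi : 'I_l -> {scalar 'M[C]_d}) (P : 'I_l -> 'M[C]_n),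
     [/\ forall i, extremal_state (phi i),
         forall i j, i != j -> ~ (phi i =1 phi j),
         (forall i, is_projection (P i)) /\
         (forall i j, i != j -> P i *m P j = 0),
         \sum_i P i = 1%:M &
         forall X, Phi X = \sum_i phi i X *: P i].

Lemma class_representatives (T U : Type) k (f : 'I_k -> T -> U) :
  exists2 r : 'I_k -> 'I_k, forall i, f i =1 f (r i) &
    forall i j, f i =1 f j -> r i = r j.
Proof.
pose e i j := `[< f i =1 f j >].
exists (fun i => odflt i [pick j | e i j]) => [i|i j ij].
  by case: pickP => [j /asboolP //|/(_ i) /asboolP]; case.
have ee : e i =1 e j.
  move=> h; apply/asboolP/asboolP => h' X; first by rewrite -ij.
  by rewrite ij.
by rewrite (eq_pick ee); case: pickP => //= /(_ j) /asboolP; case.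
Qed.

Section Holevo.
Variables (d n : nat) (Phi : {linear 'M[C]_d -> 'M[C]_n}).
Variables (m : nat) (u : 'I_m -> 'cV[C]_d) (y : 'I_m -> 'cV[C]_n).
Hypothesis H : Holevo_form Phi u y.

Lemma Holevo_adj X : Phi (X ^t*) = (Phi X) ^t*.
Proof.
case: H => _ _ E; rewrite !E adjmx_sum; apply: eq_bigr => k _.
by rewrite adjmxZ adjmx_outer vstate_adj.
Qed.

(** The range of Phi is closed under adjoints, and joint eigenvectors of such
    a family with different eigenvalues are orthogonal. *)
Lemma eigenvectors_orthogonal_blocks :
  (forall k X, Phi X *m y k = vstate (u k) X *: y k) -> orthogonal_blocks u y.
Proof.
move=> hE k l; have [|h] := eqVneq (cdot (y k) (y l)) 0; first by right.
left=> X; apply: (mulIf h).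
rewrite -cdotZl -hE cdot_adj -Holevo_adj hE vstate_adj cdotZr conjCK.
by [].
Qed.

(** The matrices y_k y_k^* are added up over the classes of equal states. The
    resulting positive matrices annihilate each other and have sum 1, hence
    they are projections. *)
Lemma orthogonal_blocks_direct_sum : orthogonal_blocks u y -> direct_sum_of_states Phi.
Proof.
case: H => u1 y1 PhiE O.
have [r er re] := class_representatives (fun k => vstate (u k)).
have rr k : r (r k) = r k by apply: re => X; rewrite -er.
pose S := [pred k | r k == k].
have Sr k : S (r k) by rewrite /= rr.
pose A k := y k *m (y k) ^t*.
have split_sum (F : 'I_m -> 'M[C]_n) :
    \sum_k F k = \sum_(i < #|S|) \sum_(k | r k == enum_val i) F k.
  rewrite (partition_big r S) //=; last by move=> k _; exact: Sr.
  by rewrite big_enum_val.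
have P1 : \sum_(i < #|S|) \sum_(k | r k == enum_val i) A k = 1%:M.
  by rewrite -split_sum.
have P0 (i j : 'I_#|S|) : i != j ->
    (\sum_(k | r k == enum_val i) A k) *m (\sum_(k | r k == enum_val j) A k) = 0.
  move=> ij; rewrite mulmx_suml big1 // => k /eqP ki.
  rewrite mulmx_sumr big1 // => l /eqP lj.
  rewrite outer_mulmx; case: (O k l) => [/re h|h].
    by case/eqP: ij; apply: enum_val_inj; rewrite -ki -lj.
  by rewrite cdotC h rmorph0 scale0r.
exists #|S|, (fun i => vstate (u (enum_val i))),
  (fun i => \sum_(k | r k == enum_val i) A k); split => //.
- by move=> i; exact: vstate_extremal.
- move=> i j ij h; case/eqP: ij; apply: enum_val_inj.
  have /eqP <- : S (enum_val i) := enum_valP i.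
  by have /eqP <- : S (enum_val j) := enum_valP j; exact: re.
- split=> // i; split.
    by rewrite adjmx_sum; apply: eq_bigr => k _; rewrite adjmx_outer.
  set Pi := \sum_(k | r k == enum_val i) A k.
  rewrite -[RHS]mulmx1 -[X in _ = _ *m X]P1 [RHS]mulmx_sumr [RHS](bigD1 i) //=.
  rewrite [X in _ = _ + X]big1 ?addr0 // => j ji.
  by apply: P0; rewrite eq_sym.
- move=> X; rewrite PhiE split_sum; apply: eq_bigr => i _.
  rewrite scaler_sumr; apply: eq_bigr => k /eqP ki.
  by rewrite -ki er.
Qed.
End Holevo.

(** [UEB_pure_vector] for operators on C^n. *)
Lemma UEB_eigenvector d n (Phi : {linear 'M[C]_d -> 'M[C]_n}) u v : UEB Phi ->
  cdot u u = 1 -> cdot (Phi (1%:M - u *m u ^t*) *m v) v = 0 ->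
  forall X, Phi X *m v = vstate u X *: v.
Proof.
move=> [hl hu hE] u1 hv X.
exact: (UEB_pure_vector hE hl hu u1 hv X).
Qed.

Lemma UEB_psd d n (Phi : {linear 'M[C]_d -> 'M[C]_n}) X :
  UEB Phi -> psdmx X -> psdmx (Phi X).
Proof.
by move=> [hl hu hE] hX v; exact: (EB_positive hE hl).
Qed.

Section DirectSum.
Variables (d n : nat) (Phi : {linear 'M[C]_d -> 'M[C]_n}).
Hypothesis H : direct_sum_of_states Phi.

Lemma direct_sum_vectors : exists l (u : 'I_l -> 'cV[C]_d) (P : 'I_l -> 'M[C]_n),
  [/\ forall i, cdot (u i) (u i) = 1, forall i, is_projection (P i),
      \sum_i P i = 1%:M,
      forall X i, Phi X *m P i = vstate (u i) X *: P i &
      forall X, Phi X = \sum_i vstate (u i) X *: P i].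
Proof.
have [l [phi [P [hphi _ [hP P0] P1 PhiE]]]] := H.
have /choice[u hu] : forall i, exists u, cdot u u = 1 /\ phi i =1 vstate u.
  by move=> i; have [u] := extremal_is_vstate (hphi i); exists u.
exists l, u, P; split => //.
- by move=> i; case: (hu i).
- move=> X i; rewrite PhiE mulmx_suml (bigD1 i) //= big1 ?addr0 => [|j ji].
    by rewrite -scalemxAl (hP i).2 (hu i).2.
  by rewrite -scalemxAl P0 // scaler0.
- by move=> X; rewrite PhiE; apply: eq_bigr => i _; rewrite (hu i).2.
Qed.

Lemma direct_sum_commutative : commutative_range Phi.
Proof.
have [l [u [P [_ _ _ hP PhiE]]]] := direct_sum_vectors.
move=> X Y; rewrite [in LHS](PhiE Y) [in RHS](PhiE X) mulmx_sumr.
have -> : Phi Y *m (\sum_i vstate (u i) X *: P i) = \sum_i (vstate (u i) X * vstate (u i) Y) *: P i.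
  by rewrite mulmx_sumr; apply: eq_bigr => i _; rewrite -scalemxAr hP scalerA.
by apply: eq_bigr => i _; rewrite -scalemxAr hP scalerA mulrC.
Qed.

Lemma direct_sum_adj X : Phi (X ^t*) = (Phi X) ^t*.
Proof.
have [l [u [P [_ hP _ _ PhiE]]]] := direct_sum_vectors.
rewrite !PhiE adjmx_sum; apply: eq_bigr => i _.
by rewrite adjmxZ (hP i).1 vstate_adj.
Qed.

(** For x in the range of P_i and Q = 1 - u_i u_i^*, the number <Phi Q x, x> = 0
    is the sum over j of the nonnegative <Phis_j Q (T_j x), T_j x>, so each of
    these vanishes and [UEB_eigenvector] applies at T_j x. *)
Lemma direct_sum_intertwine k (T : 'I_k -> 'M[C]_n)
    (Phis : 'I_k -> {linear 'M[C]_d -> 'M[C]_n}) :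
  (forall j, UEB (Phis j)) ->
  (forall X, Phi X = \sum_j (T j) ^t* *m Phis j X *m T j) ->
  forall j X, Phis j X *m T j = T j *m Phi X.
Proof.
move=> hPhis PhiE j X.
have [l [u [P [u1 hP P1 PhiP PhiE']]]] := direct_sum_vectors.
suff h i : Phis j X *m T j *m P i = T j *m Phi X *m P i.
  rewrite -[LHS]mulmx1 -[RHS]mulmx1 -P1 !mulmx_sumr.
  by apply: eq_bigr => i _.
rewrite -(mulmxA (T j)) PhiP -scalemxAr.
apply/matrixP => p q; rewrite !mxE_cdot -!mulmxA -scalemxAl -mulmxA.
congr (cdot _ _); set x := P i *m _.
apply: UEB_eigenvector => //.
set Q := 1%:M - _.
have : cdot (Phi Q *m x) x = 0.
  by rewrite /x mulmxA PhiP vstate_coproj0 // scale0r mul0mx cdot0l.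
rewrite PhiE mulmx_suml cdot_suml => /eqP; rewrite psumr_eq0; last first.
  move=> j' _; rewrite -!mulmxA cdot_adj trmxCK; apply: psdE.
  by apply: UEB_psd => //; exact: psd_coproj.
move=> /allP /(_ j); rewrite mem_index_enum => /(_ isT) /eqP.
by rewrite -!mulmxA cdot_adj trmxCK.
Qed.

(** The intertwiners are the scalars sqrt t_j. *)
Lemma direct_sum_linear_extreme : UEB Phi -> linear_extreme_UEB Phi.
Proof.
move=> hPhi; split=> // k t Phis hPhis ht _ PhiE i X.
have t0 j : 0 < t j by case/andP: (ht j).
have sr j : (sqrtC (t j))^*%R = sqrtC (t j) by rewrite geC0_conj // sqrtC_ge0 ltW.
have sn : sqrtC (t i) != 0 by rewrite sqrtC_eq0 gt_eqF.
have := @direct_sum_intertwine k (fun j => (sqrtC (t j))%:M) Phis hPhis _ i X.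
rewrite mul_mx_scalar mul_scalar_mx => h.
apply: (scalerI sn); apply: h => Y; rewrite PhiE; apply: eq_bigr => j _.
rewrite tr_scalar_mx map_scalar_mx /= sr mul_scalar_mx mul_mx_scalar scalerA.
by rewrite -expr2 sqrtCK.
Qed.

(** [UEB_pure_vector] at V x, for x in the range of one of the projections. *)
Lemma direct_sum_maximal : UEB Phi -> maximal_UEB Phi.
Proof.
move=> hPhi; split=> // K Psi V Vadj [hl hu hE] _ hV hPsi X x.
have [l [u [P [u1 hP P1 PhiP PhiE']]]] := direct_sum_vectors.
have h i : Psi X (V (P i *m x)) = V (Phi X *m (P i *m x)).
  rewrite mulmxA PhiP -scalemxAl linearZ /=.
  apply: (UEB_pure_vector hE hl hu (u1 i)).
  rewrite dotC hV -hPsi mulmxA PhiP.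
  by rewrite vstate_coproj0 // scale0r mul0mx cdot0r rmorph0.
rewrite -[x]mul1mx -P1 mulmx_suml mulmx_sumr !linear_sum.
by apply: eq_bigr => i _; rewrite h.
Qed.

(** The unitary is the adjoint of the unitary part of T: since T^* T commutes
    with the range of Phi, so does its square root S, and T S^-1 intertwines as
    T does. *)
Lemma intertwiner_unitary (Psi : {linear 'M[C]_d -> 'M[C]_n}) T :
  (forall X, Psi (X ^t*) = (Psi X) ^t*) -> T \in unitmx ->
  (forall X, Psi X *m T = T *m Phi X) ->
  exists U : 'M[C]_n, U \is unitarymx /\ forall X, Psi X = U ^t* *m Phi X *m U.
Proof.
move=> hPsi Tu hT; have [S [Sa SS Sc]] := psd_sqrt (psd_gram T).
have Tau : T ^t* \in unitmx by rewrite map_unitmx unitmx_tr.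
have Su : S \in unitmx.
  have : T ^t* *m T \in unitmx by rewrite unitmx_mul Tau.
  by rewrite -SS unitmx_mul => /andP[].
have Va : (invmx S) ^t* = invmx S.
  by rewrite trmx_inv map_invmx Sa.
have PhiS X : Phi X *m S = S *m Phi X.
  have hT' : T ^t* *m Psi X = Phi X *m T ^t*.
    apply: (can_inj (@trmxCK C n n)); rewrite !adjmxM trmxCK -hPsi -direct_sum_adj.
    by rewrite hT.
  by apply: Sc; rewrite -[RHS]mulmxA -hT [RHS]mulmxA hT' mulmxA.
have PhiV X : Phi X *m invmx S = invmx S *m Phi X.
  rewrite -[LHS]mul1mx -(mulVmx Su) -!mulmxA (mulmxA S) -PhiS -mulmxA mulmxV //.
  by rewrite mulmx1.
pose U := invmx S *m T ^t*.
have Ua : U ^t* = T *m invmx S by rewrite /U adjmxM trmxCK Va.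
have UU : U *m U ^t* = 1%:M.
  rewrite Ua /U mulmxA -(mulmxA _ (T ^t*)) -SS mulmxA mulVmx // mul1mx.
  by rewrite mulmxV.
exists U; split; first exact/unitarymxP.
move=> X; rewrite Ua -mulmxA mulmxA -mulmxA.
rewrite -[LHS]mulmx1 -(mulmx1C UU) Ua !mulmxA hT.
by rewrite -(mulmxA T) PhiV mulmxA.
Qed.

Lemma direct_sum_Cstar_extreme : UEB Phi -> Cstar_extreme_UEB Phi.
Proof.
move=> hPhi; split=> // k T Phis hPhis Tu _ PhiE.
have hU i : exists U : 'M[C]_n, U \is unitarymx /\
    forall X, Phis i X = U ^t* *m Phi X *m U.
  apply: (intertwiner_unitary (T := T i)) => //.
    have [m [u [y [h _]]]] := UEB_Holevo (hPhis i).
    exact: (Holevo_adj (u := u) (y := y)).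
  by move=> X; exact: direct_sum_intertwine.
by have [U hU'] := choice hU; exists U.
Qed.
End DirectSum.
End Forms.

(** * From extremality and maximality to joint eigenvectors *)

Section Extremality.
Variables (R : realType) (d n : nat).
Local Notation C := R[i].

Definition state_map m (phi : 'I_m -> {scalar 'M[C]_d}) (A : 'I_m -> 'M[C]_n)
    (X : 'M[C]_d) : 'M[C]_n := \sum_j phi j X *: A j.
Lemma state_map_is_linear m phi (A : 'I_m -> 'M[C]_n) : linear (state_map phi A).
Proof.
move=> a X Y; rewrite /state_map scaler_sumr -big_split; apply: eq_bigr => j _ /=.
by rewrite linearP /= scalerDl scalerA.
Qed.
HB.instance Definition _ m phi (A : 'I_m -> 'M[C]_n) :=
  GRing.isLinear.Build C 'M[C]_d 'M[C]_n *:%R (state_map phi A)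
    (state_map_is_linear phi A).

Lemma state_map_UEB m (phi : 'I_m -> {scalar 'M[C]_d}) (A : 'I_m -> 'M[C]_n) :
  (forall j, is_state (phi j)) -> (forall j, psdmx (A j)) ->
  \sum_j A j = 1%:M -> UEB (state_map phi A : {linear 'M[C]_d -> 'M[C]_n}).
Proof. by move=> h1 h2 h3; apply: (states_matrix_UEB (phi := phi) (A := A)). Qed.

Variable Phi : {linear 'M[C]_d -> 'M[C]_n}.

Section Weights.
Variables (m : nat) (u : 'I_m -> 'cV[C]_d) (y : 'I_m -> 'cV[C]_n).
Hypothesis H : Holevo_form Phi u y.
Variable g : 'I_m -> C.
Hypothesis g3 : forall l, 3^-1 <= g l.
Let A l := y l *m (y l) ^t*.

Let g0 l : 0 <= g l.
Proof. by apply: le_trans (g3 l); rewrite invr_ge0 ler0n. Qed.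

(** The component is S^-1 (sum_l g_l phi_l A_l) S^-1 with S the square root of
    sum_l g_l A_l. A lower bound on the weights makes S invertible; it is 1/3 for
    both families of weights in [Cstar_extreme_eigenvectors]. *)
Lemma weighted_component :
  exists (S : 'M[C]_n) (Phi' : {linear 'M[C]_d -> 'M[C]_n}),
  [/\ S ^t* = S, S *m S = \sum_l g l *: A l, S \in unitmx, UEB Phi' &
      forall X, S *m Phi' X *m S = \sum_l (g l * vstate (u l) X) *: A l].
Proof.
case: H => u1 y1 PhiE; set G := \sum_l g l *: A l.
have Gp : psdmx G.
  by apply: psd_sum => l _; apply: psdZ => //; exact: psd_outer.
have [S [Sa SS _]] := psd_sqrt Gp.
have Gx x : cdot x x <= 3 * cdot (G *m x) x.
  rewrite (cdot_sum_outer y1) mulmx_suml cdot_suml mulr_sumr.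
  apply: ler_sum => l _; rewrite -scalemxAl mulmx_outer !cdotZl mulrA.
  rewrite ler_peMl //; last by rewrite -ler_pdivrMl ?mulr1 ?ltr0n.
  by rewrite cdotC mulrC mul_conjC_ge0.
have Gu : G \in unitmx.
  rewrite -row_free_unit -kermx_eq0; apply/negPn/negP => /rowV0Pn[v /sub_kermxP vG v0].
  have Gv : G *m v ^t* = 0.
    by rewrite -(psd_herm Gp) -adjmxM vG adjmx0.
  have := Gx (v ^t*); rewrite Gv cdot0l mulr0 => h.
  have /eqP : cdot (v ^t*) (v ^t*) == 0 by rewrite eq_le h cdot_ge0.
  move/eqP; rewrite cdot_eq0 => /eqP /(congr1 (fun M => M ^t*)).
  by rewrite trmxCK adjmx0 => v00; rewrite v00 eqxx in v0.
have Su : S \in unitmx by move: Gu; rewrite -SS unitmx_mul => /andP[].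
have Va : (invmx S) ^t* = invmx S by rewrite trmx_inv map_invmx Sa.
pose B l := invmx S *m (g l *: A l) *m invmx S.
exists S, (state_map (fun l => vstate (u l)) B); split => //.
- apply: state_map_UEB.
  + by move=> l; exact: vstate_is_state.
  + move=> l; rewrite /B -{1}Va; apply: psd_congr; apply: psdZ => //.
    exact: psd_outer.
  + rewrite /B -mulmx_suml -mulmx_sumr -/G -SS mulmxA mulVmx // mul1mx.
    by rewrite mulmxV.
- move=> X; rewrite /= /state_map mulmx_sumr mulmx_suml; apply: eq_bigr => l _.
  rewrite -scalemxAr -scalemxAl /B !mulmxA mulmxV // mul1mx -mulmxA mulVmx //.
  by rewrite mulmx1 scalerA mulrC.
Qed.
End Weights.

Lemma tr_mul_outer (M : 'M[C]_n) (x : 'cV[C]_n) : \tr (M *m (x *m x ^t*)) = cdot (M *m x) x.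
Proof. by rewrite mulmxA tr_outer. Qed.

(** Phi is split with the weights g_l, equal to 2/3 for l = k and to 1/3
    otherwise, and 1 - g_l. The first component is unitarily equivalent to Phi,
    hence has the same trace. As the inverse of sum_l g_l A_l is the explicit
    matrix V below, equality of traces says that <Phi X y_k, y_k> is
    <X u_k, u_k> <y_k, y_k>, and [UEB_eigenvector] concludes. *)
Lemma Cstar_extreme_eigenvectors m u y : @Holevo_form R d n Phi m u y ->
  Cstar_extreme_UEB Phi -> forall k X, Phi X *m y k = vstate (u k) X *: y k.
Proof.
move=> H [hPhi hext] k; case: (H) => u1 y1 PhiE.
pose A l := y l *m (y l) ^t*.
pose g l : C := (1 + (l == k)%:R) / 3.
have i3 : (0 : C) <= 3^-1 by rewrite invr_ge0 ler0n.
have g3 l : 3^-1 <= g l.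
  by rewrite /g mulrDl mul1r lerDl mulr_ge0 ?ler0n.
have h3 l : 3^-1 <= 1 - g l.
  rewrite (_ : 1 - g l = 3^-1 + (1 - (l == k)%:R) / 3); last by rewrite /g; field.
  by rewrite lerDl mulr_ge0 // subr_ge0 lern1 leq_b1.
have [S [Psi [Sa SS Su hPsi hS]]] := weighted_component H g3.
have [S' [Psi' [Sa' SS' Su' hPsi' hS']]] := weighted_component H h3.
have [||||U hU] := hext 2 (fun i => if i == 0 then S else S')
                     (fun i => if i == 0 then Psi else Psi').
- by move=> i; case: ifP.
- by move=> i; case: ifP.
- rewrite big_ord_recl big_ord1 /= Sa Sa' SS SS' -big_split /= -y1.
  by apply: eq_bigr => l _; rewrite -scalerDl addrCA subrr addr0 scale1r.
- move=> X; rewrite big_ord_recl big_ord1 /= Sa Sa' hS hS' -big_split /= PhiE.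
  by apply: eq_bigr => l _; rewrite -scalerDl mulrBl mul1r addrCA subrr addr0.
have [Uu PsiU] := hU 0; rewrite /= in PsiU.
have trE X : \tr (Psi X) = \tr (Phi X).
  by rewrite PsiU mxtrace_mulC mulmxA (unitarymxP Uu) mul1mx.
set s := cdot (y k) (y k).
have s1 : 1 + s != 0 by rewrite gt_eqF // ltr_wpDr ?cdot_ge0.
(* The inverse of S *m S = (1 + y_k y_k^* ) / 3. *)
pose V := 3 *: (1%:M - (1 + s)^-1 *: A k).
have Ak2 : A k *m A k = s *: A k by rewrite outer_mulmx.
have GE : S *m S = 3^-1 *: (1%:M + A k).
  rewrite SS -y1 -[A k in RHS](_ : \sum_l (l == k)%:R *: A l = _); last first.
    rewrite (bigD1 k) //= eqxx scale1r big1 ?addr0 // => l lk.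
    by rewrite (negbTE lk) scale0r.
  rewrite -big_split scaler_sumr; apply: eq_bigr => l _ /=.
  by rewrite -[X in _ = _ *: (X + _)]scale1r -scalerDl scalerA /g mulrC.
have GV : S *m S *m V = 1%:M.
  rewrite GE /V -scalemxAl -scalemxAr scalerA mulVf ?pnatr_eq0 // scale1r.
  rewrite mulmxBr mulmx1 -scalemxAr mulmxDl mul1mx Ak2 -[X in X + s *: _]scale1r -scalerDl.
  by rewrite scalerA mulVf // scale1r addrK.
have VE : V = invmx S *m invmx S.
  by rewrite -[RHS]mulmx1 -GV !mulmxA mulmxKV // mulVmx // mul1mx.
have trPsi X : \tr (Psi X) = \tr ((\sum_l (g l * vstate (u l) X) *: A l) *m V).
  rewrite -hS VE [in RHS]mulmxA mulmxK // mxtrace_mulC mulmxA mulVmx //.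
  by rewrite mul1mx.
have ME X : \sum_l (g l * vstate (u l) X) *: A l
     = 3^-1 *: (Phi X + vstate (u k) X *: A k).
  rewrite PhiE -[_ *: A k in RHS](_ : \sum_l ((l == k)%:R * vstate (u l) X) *: A l = _); last first.
    rewrite (bigD1 k) //= eqxx mul1r big1 ?addr0 // => l lk.
    by rewrite (negbTE lk) mul0r scale0r.
  rewrite -big_split scaler_sumr; apply: eq_bigr => l _ /=.
  by rewrite -scalerDl scalerA /g; congr (_ *: _); field.
have key X : cdot (Phi X *m y k) (y k) = vstate (u k) X * s.
  have := trE X; rewrite trPsi ME /V -scalemxAl -scalemxAr scalerA mulVf ?pnatr_eq0 // scale1r.
  rewrite mulmxBr mulmx1 -scalemxAr mulmxDl -scalemxAl Ak2 scalerA.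
  rewrite raddfB /= raddfD /= !mxtraceZ raddfD /= !mxtraceZ tr_mul_outer tr_outer -/s.
  move=> /eqP; rewrite -subr_eq0 => /eqP h.
  apply/eqP; rewrite -subr_eq0 -[X in X == 0]opprK oppr_eq0; apply/eqP.
  transitivity ((1 + s) * (\tr (Phi X) + vstate (u k) X * s -
    (1 + s)^-1 * (cdot (Phi X *m y k) (y k) + vstate (u k) X * s * s) - \tr (Phi X))).
    by field.
  by rewrite h mulr0.
move=> X; apply: UEB_eigenvector => //.
by rewrite key vstate_coproj0 // mul0r.
Qed.

(** X |-> diag (<X u_l, u_l>) is a UEB map on C^m that dilates Phi through the
    isometry x |-> (<x, y_l>)_l. That this isometry intertwines the two maps
    means that the y_l are joint eigenvectors. *)
Lemma maximal_eigenvectors m u y : @Holevo_form R d n Phi m u y ->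
  maximal_UEB Phi -> forall k X, Phi X *m y k = vstate (u k) X *: y k.
Proof.
move=> H [hPhi hmax] k; case: (H) => u1 y1 PhiE.
pose K := euclid_Hilbert R m.
pose Y : 'M[C]_(m, n) := \matrix_(l, i) (y l i 0)^*%R.
have YE x l : (Y *m x) l 0 = cdot x (y l).
  by rewrite mxE cdotE; apply: eq_bigr => i _; rewrite mxE mulrC.
have YY : Y ^t* *m Y = 1%:M.
  rewrite -y1; apply/matrixP => i j; rewrite mxE summxE; apply: eq_bigr => l _.
  by rewrite !mxE big_ord1 !mxE conjCK.
pose D X : 'M[C]_m := \sum_l vstate (u l) X *: delta_mx l l.
have DE X (v : 'cV[C]_m) l : (D X *m v) l 0 = vstate (u l) X * v l 0.
  rewrite /D mulmx_suml summxE (bigD1 l) //= big1 ?addr0 => [|j jl].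
    rewrite -scalemxAl mxE; congr (_ * _); rewrite mxE (bigD1 l) //= big1 => [|i il].
      by rewrite mxE !eqxx mul1r addr0.
    by rewrite mxE (negbTE il) andbF mul0r.
  rewrite -scalemxAl mxE mxE big1 ?mulr0 // => i _.
  by rewrite mxE eq_sym (negbTE jl) mul0r.
pose Psi X : {linear K -> K} := (mulmx (D X) : {linear 'cV[C]_m -> 'cV[C]_m}).
pose V : {linear 'cV[C]_n -> K} := (mulmx Y : {linear 'cV[C]_n -> 'cV[C]_m}).
have hPsi : UEB_ops (@hdot R K) Psi.
  apply: (@states_UEB _ _ _ _ m (fun l => vstate (u l))
     (fun l => (mulmx (delta_mx l l) : {linear 'cV[C]_m -> 'cV[C]_m}))).
  - by move=> l; exact: vstate_is_state.
  - by move=> l; exact: mulmx_bounded.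
  - move=> l v; have -> : delta_mx l l = delta_mx l 0 *m (delta_mx l 0 : 'cV[C]_m) ^t* :> 'M[C]_m.
      apply/matrixP => i j; rewrite !mxE big_ord1 !mxE !eqxx !andbT rmorph_nat.
      by rewrite -natrM mulnb.
    exact: psd_outer.
  - move=> v /=; rewrite -[RHS](mul1mx (v : 'cV[C]_m)) -[in RHS](_ : \sum_l delta_mx l l = 1%:M).
      by rewrite mulmx_suml.
    apply/matrixP => i j; rewrite summxE (bigD1 i) //= big1 ?addr0 => [|l li].
      by rewrite !mxE eqxx /= eq_sym.
    by rewrite mxE eq_sym (negbTE li).
  - move=> X v /=; rewrite /D mulmx_suml; apply: eq_bigr => l _.
    by rewrite -scalemxAl.
have := hmax K Psi V (fun v : K => Y ^t* *m (v : 'cV[C]_m)) hPsi.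
have h1 x : `|V x| = dnorm (@cdot C n) x.
  rewrite -[LHS]/(sqrtC (cdot (Y *m x) (Y *m x))).
  by rewrite cdot_adj mulmxA YY mul1mx.
have h2 x v : hdot K (V x) v = cdot x (Y ^t* *m (v : 'cV[C]_m)).
  by rewrite -[LHS]/(cdot (Y *m x) v) cdot_adj.
have h3 X (x : 'cV[C]_n) : Phi X *m x = Y ^t* *m (D X *m (Y *m x)).
  rewrite PhiE mulmx_suml; apply/colP => i; rewrite summxE mxE; apply: eq_bigr => l _.
  rewrite DE YE -scalemxAl mulmx_outer !mxE conjCK; ring.
move=> /(_ h1 h2 h3) hV X.
have {}hV x : D (X ^t*) *m (Y *m x) = Y *m (Phi (X ^t*) *m x) := hV (X ^t*) x.
apply: cdot_eqP => x.
have /colP/(_ k) := hV x; rewrite DE !YE vstate_adj -cdotZr => h.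
by rewrite cdot_adj -(Holevo_adj H) (cdotC (y k)) -h -cdotC.
Qed.

Definition vec_functional (w : 'cV[C]_n) (X : 'M[C]_d) : C := cdot (Phi X *m w) w.
Lemma vec_functional_is_scalar w : scalar (vec_functional w).
Proof.
by move=> a X Y; rewrite /vec_functional linearP mulmxDl -scalemxAl cdotDl cdotZl.
Qed.
HB.instance Definition _ w :=
  GRing.isLinear.Build C 'M[C]_d C *%R (vec_functional w) (vec_functional_is_scalar w).

(** The Hermitian and skew-Hermitian combinations of matrix units span M_d and
    have commuting Hermitian images, up to a factor 'i; these are diagonalized
    simultaneously. *)
Lemma commutative_range_diagonal : UEB Phi -> commutative_range Phi ->
  exists w : 'I_n -> 'cV[C]_n,
  [/\ forall j, cdot (w j) (w j) = 1, forall j k, j != k -> cdot (w j) (w k) = 0,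
      \sum_j w j *m (w j) ^t* = 1%:M &
      forall X j, Phi X *m w j = vec_functional (w j) X *: w j].
Proof.
move=> hPhi hc; have [m [u [y [H _]]]] := UEB_Holevo hPhi.
pose h (i : 'I_d * 'I_d * bool) : 'M[C]_d := let: (a, b, c) := i in
  if c then delta_mx a b + delta_mx b a else 'i%R *: (delta_mx a b - delta_mx b a).
have da (a b : 'I_d) : (delta_mx a b : 'M[C]_d) ^t* = delta_mx b a.
  by rewrite trmx_delta map_delta_mx.
have [|i j|w [a [w1 wo hw]]] := @simultaneous_diag C n _ (fun i => Phi (h i)).
- move=> [[a b] [|]]; rewrite -(Holevo_adj H) /h; congr (Phi _).
    by rewrite adjmxD !da addrC.
  by rewrite adjmxZ adjmxB !da conjCi scaleNr -scalerN opprB.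
- exact: hc.
exists w; split => //.
- by move=> j; rewrite wo eqxx.
- by move=> j k jk; rewrite wo (negbTE jk).
move=> X j.
suff [c hX] : exists c, Phi X *m w j = c *: w j.
  by rewrite /vec_functional hX cdotZl wo eqxx mulr1.
have /choice[c hcc] : forall ab : 'I_d * 'I_d, exists c, Phi (delta_mx ab.1 ab.2) *m w j = c *: w j.
  move=> [p q]; exists (2^-1 * (a (p, q, true) j - 'i%R * a (p, q, false) j)).
  have -> : delta_mx p q = 2^-1 *: (h (p, q, true) - 'i%R *: h (p, q, false)).
    rewrite /h scalerA -expr2 sqrCi scaleN1r opprK addrACA subrr addr0.
    rewrite scalerDr -scalerDl (_ : 2^-1 + 2^-1 = 1) ?scale1r //.
    by field.
  have := hw (p, q, false) j; have := hw (p, q, true) j.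
  move: (h (p, q, true)) (h (p, q, false)) => h1 h2 e1 e2.
  rewrite linearZ linearB linearZ /= -scalemxAl mulmxBl -scalemxAl e1 e2.
  by rewrite scalerA -scalerBl scalerA.
exists (\sum_p \sum_q X p q * c (p, q)).
rewrite linear_delta_sum mulmx_suml scaler_suml; apply: eq_bigr => p _.
rewrite mulmx_suml scaler_suml; apply: eq_bigr => q _.
by rewrite -scalemxAl (hcc (p, q)) scalerA.
Qed.

(** In an orthonormal basis of joint eigenvectors Phi is the direct sum of the
    states psi_j. A convex decomposition of one psi_j, the others being kept,
    decomposes Phi; so each psi_j is extremal, hence a vector state. *)
Lemma linear_extreme_commutative_Holevo :
  linear_extreme_UEB Phi -> commutative_range Phi ->
  exists (u : 'I_n -> 'cV[C]_d) (w : 'I_n -> 'cV[C]_n),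
    Holevo_form Phi u w /\ forall j, w j != 0.
Proof.
move=> [hPhi hext] hc.
have [w [w1 wo ww hw]] := commutative_range_diagonal hPhi hc.
pose psi j : {scalar 'M[C]_d} := vec_functional (w j).
have PhiE X : Phi X = \sum_j psi j X *: (w j *m (w j) ^t*).
  rewrite -[LHS]mulmx1 -ww mulmx_sumr; apply: eq_bigr => j _.
  by rewrite mulmxA hw -scalemxAl.
have hpsi j : is_state (psi j).
  split=> [|X hX]; rewrite /= /vec_functional.
    by rewrite unital_matrix // mul1mx w1.
  exact/psdE/UEB_psd.
have psi_ext j : extremal_state (psi j).
  split=> // psi1 psi2 t s1 s2 t01 e.
  pose alt (q : {scalar 'M[C]_d}) l := if l == j then q else psi l.
  have hU (q : {scalar 'M[C]_d}) : is_state q ->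
      UEB (state_map (alt q) (fun l => w l *m (w l) ^t*) : {linear _ -> _}).
    move=> hq; apply: state_map_UEB => // l; last exact: psd_outer.
    by rewrite /alt; case: ifP.
  have smE q X : state_map (alt q) (fun l => w l *m (w l) ^t*) X =
      q X *: (w j *m (w j) ^t*) + \sum_(l | l != j) psi l X *: (w l *m (w l) ^t*).
    rewrite /state_map (bigD1 j) //= {1}/alt eqxx; congr (_ + _).
    by apply: eq_bigr => l lj; rewrite /alt (negbTE lj).
  pose mixed (i : 'I_2) : {linear 'M[C]_d -> 'M[C]_n} :=
    state_map (alt (if i == 0 then psi1 else psi2)) (fun l => w l *m (w l) ^t*).
  have hmix X : Phi X = \sum_i (if i == 0 then t else 1 - t) *: mixed i X.
    rewrite big_ord_recl big_ord1 /= !smE PhiE (bigD1 j) //= e.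
    rewrite !scalerDr !scalerA addrACA -!scalerDl.
    by congr (_ + _); rewrite addrCA subrr addr0 scale1r.
  have /andP[t0 t1] := t01.
  have c1 i : UEB (mixed i) by apply: hU; case: ifP.
  have c2 (i : 'I_2) : 0 < (if i == 0 then t else 1 - t) < 1.
    by case: ifP => _ //; rewrite subr_gt0 t1 gtrBl t0.
  have c3 : \sum_(i < 2) (if i == 0 then t else 1 - t) = 1.
    by rewrite big_ord_recl big_ord1 /= addrCA subrr addr0.
  have hi := hext 2 _ mixed c1 c2 c3 hmix.
  have read q X : state_map (alt q) (fun l => w l *m (w l) ^t*) X = Phi X -> q X = psi j X.
    move=> /(congr1 (fun M => cdot (M *m w j) (w j))).
    rewrite -[RHS]/(psi j X) smE mulmxDl cdotDl -scalemxAl cdotZl mulmx_outer cdotZl !w1 !mulr1.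
    rewrite mulmx_suml cdot_suml big1 ?addr0 // => l lj.
    by rewrite -scalemxAl mulmx_outer !cdotZl wo ?mul0r ?mulr0 // eq_sym.
  by split=> X; apply: read; [exact: (hi ord0 X)|exact: (hi ord_max X)].
have /choice[u hu] : forall j, exists u, cdot u u = 1 /\ psi j =1 vstate u.
  by move=> j; have [u] := extremal_is_vstate (psi_ext j); exists u.
exists u, w; split; last by move=> j; rewrite -cdot_eq0 w1 oner_eq0.
split=> // [k|X]; first by case: (hu k).
by rewrite PhiE; apply: eq_bigr => j _; rewrite (hu j).2.
Qed.
End Extremality.

(** * Kraus decompositions *)

Section Kraus.
Variables (R : realType) (d n : nat).
Local Notation C := R[i].
Implicit Type Phi : {linear 'M[C]_d -> 'M[C]_n}.

Lemma mulmx_delta_mulE k l (A : 'M[C]_(k, d)) (B : 'M[C]_(d, l)) a b p q :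
  (A *m delta_mx a b *m B) p q = A p a * B b q.
Proof.
rewrite -(mul_delta_mx (0 : 'I_1) a b) mulmxA -colE -mulmxA -rowE mxE big_ord1.
by rewrite !mxE.
Qed.

Lemma mxtrace_mul_delta (M : 'M[C]_d) a b : \tr (M *m delta_mx b a) = M a b.
Proof.
rewrite -(mul_delta_mx (0 : 'I_1) b a) mulmxA mxtrace_mulC /mxtrace big_ord1.
by rewrite -rowE -colE !mxE.
Qed.

Lemma mxtrace_delta_delta (M N : 'M[C]_d) a b :
  \tr (M *m delta_mx a b *m N *m delta_mx b a) = M a a * N b b.
Proof. by rewrite mxtrace_mul_delta mulmx_delta_mulE. Qed.

(** Both sides are the trace of the square of the Choi matrix, so the right
    hand side is the same for all Kraus decompositions of Phi. *)
Lemma Kraus_overlap Phi k (W : 'I_k -> 'M[C]_(d, n)) : Kraus_decomposition Phi W ->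
  \sum_a \sum_b \tr (Phi (delta_mx a b) *m Phi (delta_mx b a)) =
  \sum_i \sum_j `|\tr (W i *m (W j) ^t*)| ^+ 2.
Proof.
move=> hW.
transitivity (\sum_a \sum_b \sum_i \sum_j
    ((W j *m (W i) ^t*) a a * (W i *m (W j) ^t*) b b)).
  apply: eq_bigr => a _; apply: eq_bigr => b _.
  rewrite !hW mulmx_suml raddf_sum; apply: eq_bigr => i _.
  rewrite mulmx_sumr raddf_sum; apply: eq_bigr => j _ /=.
  rewrite -mxtrace_delta_delta !mulmxA.
  by rewrite [LHS]mxtrace_mulC !mulmxA.
under eq_bigr => a _ do rewrite exchange_big /=.
rewrite exchange_big; apply: eq_bigr => i _ /=.
under eq_bigr => a _ do rewrite exchange_big /=.
rewrite exchange_big; apply: eq_bigr => j _ /=.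
under eq_bigr => a _ do rewrite -mulr_sumr.
rewrite -mulr_suml normCK mulrC; congr (_ * _).
rewrite /mxtrace rmorph_sum; apply: eq_bigr => a _.
transitivity (((W i *m (W j) ^t*) ^t*) a a); last by rewrite adjmxE.
by rewrite adjmxM trmxCK.
Qed.

Lemma Kraus_trace Phi k (W : 'I_k -> 'M[C]_(d, n)) : Kraus_decomposition Phi W ->
  Phi 1%:M = 1%:M -> \sum_i \tr (W i *m (W i) ^t*) = n%:R.
Proof.
move=> hW h1; rewrite -(mxtrace1 C n) -h1 hW raddf_sum; apply: eq_bigr => i _ /=.
by rewrite mulmx1 mxtrace_mulC.
Qed.

Lemma Holevo_Kraus Phi m (u : 'I_m -> 'cV[C]_d) (y : 'I_m -> 'cV[C]_n) :
  Holevo_form Phi u y -> Kraus_decomposition Phi (fun k => u k *m (y k) ^t*).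
Proof.
move=> [_ _ PhiE] X; rewrite PhiE; apply: eq_bigr => k _.
rewrite adjmx_outer !mulmxA -(mulmxA (y k) _ X) -(mulmxA (y k) _ (u k)).
have -> : (u k) ^t* *m X *m u k = (vstate (u k) X)%:M.
  by rewrite [LHS]mx11_scalar /vstate /cdot mulmxA.
by rewrite mul_mx_scalar scalemxAl.
Qed.

(** With p_ij = |<y_j, y_i>|^2, whose sum is n, and g_ij = |<u_i, u_j>|^2 <= 1,
    the purity of the Choi matrix is n - sum_ij p_ij (1 - g_ij). With the
    numbers w_i = tr (W_i W_i^* ), whose sum is n as well, it is at least
    sum_i w_i^2 = 2 n - k + sum_i (w_i - 1)^2. Hence n <= k, and for k = n every
    p_ij (1 - g_ij) vanishes; g_ij = 1 means that the states coincide. *)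
Lemma Kraus_length Phi m (u : 'I_m -> 'cV[C]_d) (y : 'I_m -> 'cV[C]_n)
    k (W : 'I_k -> 'M[C]_(d, n)) :
  Holevo_form Phi u y -> Kraus_decomposition Phi W ->
  (n <= k)%N /\ (k = n -> orthogonal_blocks u y).
Proof.
move=> H hW; case: (H) => u1 y1 PhiE.
have Phi1 : Phi 1%:M = 1%:M.
  rewrite PhiE -y1; apply: eq_bigr => l _.
  by rewrite vstate1 u1 scale1r.
pose p i j : C := `|cdot (y j) (y i)| ^+ 2.
pose g i j : C := `|cdot (u i) (u j)| ^+ 2.
have p0 i j : 0 <= p i j by rewrite exprn_ge0.
have g1 i j : 0 <= 1 - g i j.
  rewrite subr_ge0 /g -(expr1n _ 2) ler_pXn2r ?nnegrE ?ler01 //.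
  have h : `|cdot (u i) (u j)| <= sqrtC (cdot (u i) (u i)) * sqrtC (cdot (u j) (u j)) :=
    Cauchy_Schwarz (@cdot C d) (u i) (u j).
  by rewrite !u1 sqrtC1 mulr1 in h.
have pn : \sum_i \sum_j p i j = n%:R.
  rewrite exchange_big -(mxtrace1 C n) -y1 raddf_sum; apply: eq_bigr => j _ /=.
  rewrite tr_outer [RHS](cdot_sum_outer y1); apply: eq_bigr => i _.
  by rewrite /p normCK -cdotC.
have PW : \sum_i \sum_j `|\tr (W i *m (W j) ^t*)| ^+ 2 = n%:R - \sum_i \sum_j p i j * (1 - g i j).
  rewrite -(Kraus_overlap hW) (Kraus_overlap (Holevo_Kraus H)) -pn -sumrB.
  apply: eq_bigr => i _; rewrite -sumrB; apply: eq_bigr => j _.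
  rewrite adjmx_outer outer_mulmx mxtraceZ tr_outer normrM exprMn -/(p i j) -/(g i j).
  by rewrite mulrBr mulr1 opprB addrCA subrr addr0.
have w0 i : 0 <= \tr (W i *m (W i) ^t*).
  rewrite /mxtrace; apply: sumr_ge0 => a _; rewrite mxE; apply: sumr_ge0 => b _.
  by rewrite adjmxE mul_conjC_ge0.
have PW2 : n%:R + n%:R - k%:R <= \sum_i \sum_j `|\tr (W i *m (W j) ^t*)| ^+ 2.
  apply: (@le_trans _ _ (\sum_i (\tr (W i *m (W i) ^t*)) ^+ 2)); last first.
    apply: ler_sum => i _; rewrite (bigD1 i) //= ger0_norm // lerDl.
    by apply: sumr_ge0 => j _; rewrite exprn_ge0.
  rewrite -subr_ge0.
  have -> : \sum_i (\tr (W i *m (W i) ^t*)) ^+ 2 - (n%:R + n%:R - k%:R) =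
     \sum_i (\tr (W i *m (W i) ^t*) - 1) ^+ 2.
    rewrite -(Kraus_trace hW Phi1) -[k in k%:R]card_ord -sum1_card natr_sum.
    rewrite -big_split -sumrB -sumrB; apply: eq_bigr => i _ /=; ring.
  apply: sumr_ge0 => i _; rewrite real_exprn_even_ge0 //.
  by rewrite rpredB ?ger0_real.
have D0 : 0 <= \sum_i \sum_j p i j * (1 - g i j).
  by apply: sumr_ge0 => i _; apply: sumr_ge0 => j _; rewrite mulr_ge0.
rewrite PW in PW2; split.
  rewrite -(ler_nat C) -subr_ge0; apply: le_trans D0 _.
  by rewrite -subr_ge0 in PW2; rewrite -subr_ge0; congr (0 <= _): PW2; ring.
move=> kn; move: PW2; rewrite kn addrK lerBrDl gerDr => D0'.
have /eqP : \sum_i \sum_j p i j * (1 - g i j) = 0 by apply/eqP; rewrite eq_le D0' D0.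
rewrite psumr_eq0 => [/allP hi i j|i _]; last by apply: sumr_ge0 => j _; rewrite mulr_ge0.
have := hi i; rewrite mem_index_enum => /(_ isT).
rewrite psumr_eq0 => [/allP /(_ j)|j' _]; last by rewrite mulr_ge0.
rewrite mem_index_enum => /(_ isT); rewrite /= mulf_eq0 /p sqrf_eq0 normr_eq0.
move=> /orP[/eqP h|/eqP h]; first by right; rewrite cdotC h rmorph0.
left=> X; apply/esym; move: X; apply: state_eq_vstate => //.
  exact: vstate_is_state.
by rewrite /= vstate_coproj u1 -h /g normCK -cdotC mulrC.
Qed.

Lemma Kraus_decompositionP Phi k (V : 'I_k -> 'M[C]_(d, n)) :
  Kraus_decomposition Phi V <->
  forall a b p q, Phi (delta_mx a b) p q = \sum_i (V i a p)^*%R * V i b q.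
Proof.
have E (W : 'M[C]_(d, n)) a b p q : (W ^t* *m delta_mx a b *m W) p q = (W a p)^*%R * W b q.
  by rewrite mulmx_delta_mulE adjmxE.
split=> [h a b p q|h X].
  by rewrite h summxE; apply: eq_bigr => i _; rewrite E.
rewrite linear_delta_sum; under [RHS]eq_bigr => i _ do
  rewrite {1}[X]matrix_sum_delta mulmx_sumr mulmx_suml.
rewrite [RHS]exchange_big; apply: eq_bigr => a _ /=.
under [RHS]eq_bigr => i _ do rewrite mulmx_sumr mulmx_suml.
rewrite [RHS]exchange_big; apply: eq_bigr => b _ /=.
under [RHS]eq_bigr => i _ do rewrite -scalemxAr -scalemxAl.
rewrite -scaler_sumr; congr (_ *: _); apply/matrixP => p q.
by rewrite h summxE; apply: eq_bigr => i _; rewrite E.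
Qed.

Lemma Choi_matrixE Phi a p b q :
  Choi_matrix Phi (mxtens_index (a, p)) (mxtens_index (b, q)) = Phi (delta_mx a b) p q.
Proof.
rewrite /Choi_matrix summxE (bigD1 a) //= [X in _ + X]big1 ?addr0 => [|a' aa]; last first.
  rewrite summxE big1 // => b' _; rewrite tensmxE mxE eq_sym (negbTE aa) mul0r.
  by [].
rewrite summxE (bigD1 b) //= [X in _ + X]big1 ?addr0 => [|b' bb]; last first.
  by rewrite tensmxE mxE (eq_sym b) (negbTE bb) andbF mul0r.
by rewrite tensmxE mxE !eqxx mul1r.
Qed.

(** The conjugation matches the Choi matrix: entry (p, q) of Phi at the matrix
    unit (a, b) is the sum of V_ap^* V_bq. *)
Definition Kraus_vector (V : 'M[C]_(d, n)) : 'cV[C]_(d * n) :=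
  \col_r (V (mxtens_unindex r).1 (mxtens_unindex r).2)^*%R.
Definition Kraus_of_vector (xi : 'cV[C]_(d * n)) : 'M[C]_(d, n) :=
  \matrix_(a, p) (xi (mxtens_index (a, p)) 0)^*%R.

Lemma Kraus_vectorK : cancel Kraus_vector Kraus_of_vector.
Proof.
by move=> V; apply/matrixP => a p; rewrite !mxE mxtens_indexK conjCK.
Qed.
Lemma Kraus_of_vectorK : cancel Kraus_of_vector Kraus_vector.
Proof.
move=> xi; apply/colP => r; rewrite !mxE conjCK -surjective_pairing.
by rewrite mxtens_unindexK.
Qed.

Lemma Choi_Kraus Phi k (V : 'I_k -> 'M[C]_(d, n)) :
  Choi_matrix Phi = \sum_j Kraus_vector (V j) *m (Kraus_vector (V j)) ^t* <->
  Kraus_decomposition Phi V.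
Proof.
rewrite Kraus_decompositionP; split=> [h a b p q|h].
  rewrite -Choi_matrixE h summxE; apply: eq_bigr => j _.
  by rewrite mxE big_ord1 !mxE !mxtens_indexK conjCK.
apply/matrixP => r s; case: (mxtens_indexP r) => a p; case: (mxtens_indexP s) => b q.
rewrite Choi_matrixE h summxE; apply: eq_bigr => j _.
by rewrite mxE big_ord1 !mxE !mxtens_indexK conjCK.
Qed.

Lemma rank1P (V : 'M[C]_(d, n)) : \rank V = 1%N <->
  V != 0 /\ exists (u : 'cV[C]_d) (y : 'cV[C]_n), V = u *m y ^t*.
Proof.
split=> [r1|[V0 [u [y VE]]]].
  split; first by rewrite -mxrank_eq0 r1.
  have := mulmx_base V; move: (col_base V) (row_base V); rewrite r1 => A B <-.
  by exists A, (B ^t*); rewrite trmxCK.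
apply/eqP; rewrite eqn_leq lt0n mxrank_eq0 V0 andbT VE.
by apply: leq_trans (mxrankM_maxl _ _) (rank_leq_col _).
Qed.

Lemma Schmidt_rank1P (xi : 'cV[C]_(d * n)) : is_Schmidt_rank xi 1 <->
  xi != 0 /\ exists (x : 'cV[C]_d) (y : 'cV[C]_n), xi = x *t y.
Proof.
split=> [[[x [y E]] hmin]|[xi0 [x [y E]]]].
  split; last by exists (x 0), (y 0); rewrite E big_ord1.
  apply/eqP => xi0; suff : (0 < 0)%N by [].
  apply: hmin; exists (fun=> 0), (fun=> 0).
  by rewrite big_ord0 xi0.
split; first by exists (fun=> x), (fun=> y); rewrite big_ord1.
move=> [|//] [x' [y' E']]; rewrite big_ord0 in E'.
by rewrite E' eqxx in xi0.
Qed.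

Lemma Kraus_vector0 V : (Kraus_vector V == 0) = (V == 0).
Proof.
apply/eqP/eqP => h; last first.
  by rewrite h; apply/colP => r; rewrite !mxE rmorph0.
rewrite -[V]Kraus_vectorK h; apply/matrixP => a p.
by rewrite !mxE rmorph0.
Qed.

Lemma Schmidt_rank_Kraus (V : 'M[C]_(d, n)) :
  is_Schmidt_rank (Kraus_vector V) 1 <-> \rank V = 1%N.
Proof.
have tE (x : 'cV[C]_d) (y : 'cV[C]_n) a p :
    (x *t y : 'cV[C]_(d * n)) (mxtens_index (a, p)) 0 = x a 0 * y p 0.
  by rewrite mxE mxtens_indexK /= [X in x a X]ord1 [X in y p X]ord1.
rewrite Schmidt_rank1P rank1P Kraus_vector0.
split=> -[V0 [x [y E]]]; split => //.
  exists (map_mx (@Num.conj C) x), y; rewrite -[V]Kraus_vectorK E.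
  apply/matrixP => a p; rewrite mxE tE mxE big_ord1 !mxE.
  by rewrite rmorphM.
exists (map_mx (@Num.conj C) x), y; apply/colP => r.
case: (mxtens_indexP r) => a p; rewrite tE.
rewrite mxE mxtens_indexK /= E mxE big_ord1 !mxE.
by rewrite rmorphM /= conjCK.
Qed.

Lemma Holevo_rank1 m (u : 'I_m -> 'cV[C]_d) (y : 'I_m -> 'cV[C]_n) :
  (forall k, cdot (u k) (u k) = 1) -> (forall k, y k != 0) ->
  forall k, \rank (u k *m (y k) ^t*) = 1%N.
Proof.
move=> u1 y0 k; apply/rank1P; split; last by exists (u k), (y k).
apply/eqP => /(congr1 (fun M => M ^t* *m u k)).
rewrite adjmx_outer mulmx_outer u1 scale1r adjmx0 mul0mx => yk.
by have := y0 k; rewrite yk eqxx.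
Qed.

Section Equivalences.
Variable Phi : {linear 'M[C]_d -> 'M[C]_n}.
Hypothesis UEB_Phi : UEB Phi.

Lemma UEB_Kraus_length k (W : 'I_k -> 'M[C]_(d, n)) :
  Kraus_decomposition Phi W -> (n <= k)%N.
Proof.
have [m [u [y [H _]]]] := UEB_Holevo UEB_Phi.
by move=> /(Kraus_length H) [].
Qed.

Definition short_rank1_Kraus : Prop := exists W : 'I_n -> 'M[C]_(d, n),
  (forall i, \rank (W i) = 1%N) /\ Kraus_decomposition Phi W.

Lemma short_Kraus_direct_sum (W : 'I_n -> 'M[C]_(d, n)) :
  Kraus_decomposition Phi W -> direct_sum_of_states Phi.
Proof.
have [m [u [y [H _]]]] := UEB_Holevo UEB_Phi.
move=> /(Kraus_length H) [_ /(_ erefl)].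
exact: orthogonal_blocks_direct_sum.
Qed.

Lemma eigenvectors_direct_sum :
  (forall m u y, @Holevo_form R d n Phi m u y ->
     forall k X, Phi X *m y k = vstate (u k) X *: y k) ->
  direct_sum_of_states Phi.
Proof.
have [m [u [y [H _]]]] := UEB_Holevo UEB_Phi.
move=> h; apply: (orthogonal_blocks_direct_sum H).
exact: (eigenvectors_orthogonal_blocks H (h _ _ _ H)).
Qed.

Lemma extreme_commutative_short_rank1_Kraus :
  linear_extreme_UEB Phi -> commutative_range Phi -> short_rank1_Kraus.
Proof.
move=> h1 h2; have [u [w [H w0]]] := linear_extreme_commutative_Holevo h1 h2.
exists (fun j => u j *m (w j) ^t*); split; last exact: Holevo_Kraus.
by case: H => u1 _ _; exact: Holevo_rank1.
Qed.

Lemma direct_sum_short_rank1_Kraus : direct_sum_of_states Phi -> short_rank1_Kraus.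
Proof.
move=> h; apply: extreme_commutative_short_rank1_Kraus.
  exact: direct_sum_linear_extreme.
exact: direct_sum_commutative.
Qed.
End Equivalences.
End Kraus.

Theorem theorem6p2 (R : realType) (d n : nat)
    (Phi : {linear 'M[R[i]]_d -> 'M[R[i]]_n}) (UEB_Phi : UEB Phi) :
  [<->
   (* (i) *)
   Cstar_extreme_UEB Phi;
   (* (ii) *)
   linear_extreme_UEB Phi /\ commutative_range Phi;
   (* (iii) *)
   maximal_UEB Phi;
   (* (iv) *)
   exists (l : nat) (phi : 'I_l -> {scalar 'M[R[i]]_d}) (P : 'I_l -> 'M[R[i]]_n),
     [/\ forall i, extremal_state (phi i),
         forall i j, i != j -> ~ (phi i =1 phi j),
         (forall i, is_projection (P i)) /\
         (forall i j, i != j -> P i *m P j = 0),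
         \sum_i P i = 1%:M &
         forall X, Phi X = \sum_i phi i X *: P i];
   (* (v) *)
   is_Choi_rank Phi n;
   (* (vi) *)
   forall (m : nat) (xi : 'I_m -> 'cV[R[i]]_(d * n)),
     (forall j, is_Schmidt_rank (xi j) 1) ->
     Choi_matrix Phi = \sum_j xi j *m (xi j) ^t* ->
     (n <= m)%N /\
     exists gamma : 'I_n -> 'cV[R[i]]_(d * n),
       (forall j, is_Schmidt_rank (gamma j) 1) /\
       Choi_matrix Phi = \sum_j gamma j *m (gamma j) ^t*;
   (* (vii) *)
   forall (k : nat) (V : 'I_k -> 'M[R[i]]_(d, n)),
     (forall i, \rank (V i) = 1%N) ->
     Kraus_decomposition Phi V ->
     (n <= k)%N /\
     exists W : 'I_n -> 'M[R[i]]_(d, n),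
       (forall i, \rank (W i) = 1%N) /\ Kraus_decomposition Phi W;
   (* (viii) *)
   is_EB_rank Phi n].
Proof.
pose D := direct_sum_of_states Phi; pose N := short_rank1_Kraus Phi.
have DN : D -> N by exact: direct_sum_short_rank1_Kraus.
have ND : N -> D by move=> [W [_ hW]]; exact: short_Kraus_direct_sum hW.
have low k W : @Kraus_decomposition R d n Phi k W -> (n <= k)%N.
  exact: UEB_Kraus_length.
have [m0 [u0 [y0 [H0 y0n]]]] := UEB_Holevo UEB_Phi.
have V0 := Holevo_Kraus H0.
have r0 := Holevo_rank1 (let: And3 h _ _ := H0 in h) y0n.
tfae.
- move=> h; have hD : D.
    by apply: eigenvectors_direct_sum => // m u y H; exact: Cstar_extreme_eigenvectors.
  by split; [exact: direct_sum_linear_extreme|exact: direct_sum_commutative].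
- move=> [h1 h2]; apply: direct_sum_maximal => //; apply: ND.
  exact: extreme_commutative_short_rank1_Kraus.
- move=> h.
  by apply: eigenvectors_direct_sum => // m u y H; exact: maximal_eigenvectors.
- move=> /DN [W [_ hW]]; split; first by exists W.
  by move=> m [V /low].
- move=> [[W hW] _] m xi hxi Cxi.
  have [W' [rW' hW']] : N by apply/DN/(short_Kraus_direct_sum UEB_Phi hW).
  split.
    apply: (low _ (fun j => Kraus_of_vector (xi j))); apply/Choi_Kraus.
    by rewrite Cxi; apply: eq_bigr => j _; rewrite Kraus_of_vectorK.
  exists (fun j => Kraus_vector (W' j)); split; last exact/Choi_Kraus.
  by move=> j; exact/Schmidt_rank_Kraus.
- move=> h k V rV hV; split; first exact: low hV.
  have [||_ [gamma [rg Cg]]] := h _ (fun j => Kraus_vector (u0 j *m (y0 j) ^t*)).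
  + by move=> j; apply/Schmidt_rank_Kraus.
  + exact/Choi_Kraus.
  exists (fun j => Kraus_of_vector (gamma j)); split.
    by move=> j; apply/Schmidt_rank_Kraus; rewrite Kraus_of_vectorK.
  apply/Choi_Kraus; rewrite Cg; apply: eq_bigr => j _.
  by rewrite Kraus_of_vectorK.
- move=> h; have [_ [W hW]] := h _ _ r0 V0.
  by split; [exists W|move=> m [V [_ /low]]].
- move=> [[W hW] _].
  by apply: direct_sum_Cstar_extreme => //; apply: ND; exists W.
Qed.
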